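(* For any $f\in C_b(X,\mathbb R)$, the set $\mathrm{Eq}(f)$ of all equilibrium states for $f$ is a compact (with respect to the weak-$*$ topology) and convex subset of $\mathscr M^a_\sigma(X)$.
   Context: $(E,d_E)$ is a complete separable metric space with its Borel sigma-algebra (a standard Borel space), $p$ is a fixed Borel probability measure on $E$, and $X=E^{\mathbb N}$ with metric $d_X(x,y)=\sum_{n\ge1}2^{-n}\min\{d_E(x_n,y_n),1\}$ and left shift $\sigma(x_1,x_2,\dots)=(x_2,x_3,\dots)$. $C_b(X,\mathbb R)$ is the Banach space of bounded continuous real functions with the supremum norm. $rba(X)$ is the space of bounded, regular, finitely additive signed measures on the Borel sigma-algebra of $X$ (regular: for each Borel $A$ and $\varepsilon>0$ there are a closed $F\subset A$ and an open $O\supset A$ with $|\mu(C)|<\varepsilon$ for all Borel $C\subset O\setminus F$), identified with $C_b(X,\mathbb R)^*$ via integration $\langle\mu,f\rangle=\mu(f)=\int_Xf\,d\mu$. $\mathscr M_1^a(X)=\{\mu\in rba(X):\mu(1)=1,\ \mu(f)\ge0\ \forall f\in C_b(X,\mathbb R), f\ge 0\}$ and $\mathscr M^a_\sigma(X)=\{\mu\in\mathscr M_1^a(X):\mu(f\circ\sigma)=\mu(f)\ \forall f\in C_b(X,\mathbb R)\}$, with the weak-$*$ topology induced by $C_b(X,\mathbb R)$. Fix $0<\alpha<1$; $\mathrm{Hol}(\alpha)=\{f\in C_b(X,\mathbb R):\mathrm D_\alpha(f)<\infty\}$, $\mathrm D_\alpha(f)=\sup_{x\ne y}|f(x)-f(y)|/d_X(x,y)^\alpha$.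 The Ruelle operator is $\mathscr L_f\varphi(x)=\int_Ee^{f(ax)}\varphi(ax)\,dp(a)$, $ax=(a,x_1,x_2,\dots)$, with dual $\mathscr L_f^*$ on $rba(X)$. For $g\in\mathrm{Hol}(\alpha)$ there is a unique countably additive Borel probability measure $\nu_g$ with $\mathscr L_g^*\nu_g=\lambda_g\nu_g$ for some $\lambda_g>0$; $\lambda_g$ denotes this eigenvalue. The entropy of $\mu\in rba(X)$ is $\mathrm h^{\mathrm v}(\mu)=\inf_{g\in\mathrm{Hol}(\alpha)}\big(-\langle\mu,g\rangle+\log\lambda_g\big)\in[-\infty,\infty)$. The pressure is $P(f)=\sup_{\mu\in\mathscr M^a_\sigma(X)}\mathrm h^{\mathrm v}(\mu)+\langle\mu,f\rangle$, and $\mathrm{Eq}(f)=\{\mu\in\mathscr M^a_\sigma(X):\mathrm h^{\mathrm v}(\mu)+\langle\mu,f\rangle=P(f)\}$. *)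

(* Defs.v *)
From HB Require Import structures.
From mathcomp Require Import all_boot all_order all_algebra.
From mathcomp Require Import all_classical all_reals all_analysis.

Set Implicit Arguments.
Unset Strict Implicit.
Unset Printing Implicit Defensive.

Import Order.TTheory GRing.Theory Num.Theory.
Import numFieldNormedType.Exports.

Local Open Scope classical_set_scope.
Local Open Scope ring_scope.

Notation borel T := (g_sigma_algebraType (@open T)).

Definition separable (T : topologicalType) : Prop :=
  exists2 D : set T, countable D & dense D.

(* Pointedness is required by [measurableType]; it is no restriction for a
   space that carries a probability measure. *)
#[short(type="completePMetricType")]
HB.structure Definition CompletePMetric (R : numDomainType) :=
  {T of Metric R T & Complete T & Pointed T}.

(* Coordinates are indexed from 0, so that [x n] is the (n+1)-st coordinate. *)
Definition seqspace (E : Type) : Type := nat -> E.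

Definition shift (E : Type) (x : seqspace E) : seqspace E := fun n => x n.+1.

Definition scons (E : Type) (a : E) (x : seqspace E) : seqspace E :=
  fun n => if n is m.+1 then x m else a.

Definition seqdist (R : realType) (E : metricType R) (x y : seqspace E) : R :=
  limn [series 2 ^- n.+1 * Num.min (mdist (x n) (y n)) 1]_n.

Section seqdist_metric.
Context (R : realType) (E : metricType R).
Implicit Types x y z : seqspace E.

Let term x y (n : nat) : R := 2 ^- n.+1 * Num.min (mdist (x n) (y n)) 1.

Let term_ge0 x y n : 0 <= term x y n.
Proof.
by rewrite mulr_ge0 ?invr_ge0 ?exprn_ge0// le_min mdist_ge0 ler01.
Qed.

Let cvg_term x y : cvgn (series (term x y)).
Proof.
apply: (@series_le_cvg _ _ (geometric 2^-1 2^-1)).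
- exact: term_ge0.
- by move=> n; rewrite /geometric /= mulr_ge0 ?exprn_ge0 ?invr_ge0.
- move=> n; rewrite /term /geometric /= exprVn exprS invfM.
  rewrite ler_piMr ?mulr_ge0 ?invr_ge0 ?exprn_ge0//.
  by rewrite ge_min lexx orbT.
- apply: is_cvg_geometric_series.
  by rewrite ger0_norm ?invr_ge0// invf_lt1// ltr1n.
Qed.

Let seqdistxx x : seqdist x x = 0.
Proof.
rewrite /seqdist (_ : series _ = cst 0) ?lim_cst//.
apply/funext => n; rewrite /series /= big1// => i _.
by rewrite mdistxx min_l ?mulr0.
Qed.

Let term_le x y n : term x y n <= seqdist x y.
Proof.
have h : series (term x y) n.+1 <= limn (series (term x y)).
  apply: nondecreasing_cvgn_le; last exact: cvg_term.
  by apply: nondecreasing_series => i _ _; exact: term_ge0.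
apply: le_trans h; rewrite seriesEnat /= big_nat_recr//= lerDr.
by rewrite sumr_ge0.
Qed.

Let seqdist_positivity x y : seqdist x y = 0 -> x = y.
Proof.
move=> xy0; apply/funext => n; apply: (@mdist_positivity R).
have : term x y n <= 0 by rewrite -xy0 term_le.
rewrite /term pmulr_rle0 ?invr_gt0 ?exprn_gt0// ge_min.
rewrite (lt_geF ltr01) orbF => d0.
by apply/eqP; rewrite eq_le d0 mdist_ge0.
Qed.

Let seqdist_sym x y : seqdist x y = seqdist y x.
Proof.
rewrite /seqdist; congr (limn _); apply/funext => n; rewrite /series /=.
by apply: eq_bigr => i _; rewrite metric_sym.
Qed.

Let seqdist_triangle y x z : seqdist x z <= seqdist x y + seqdist y z.
Proof.
have cvgS := @cvg_term.
suff h : seqdist x z <= limn (series (term x y) \+ series (term y z)).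
  by rewrite limD in h; [exact: h|exact: cvgS|exact: cvgS].
apply: ler_lim; first exact: cvgS.
  by apply: is_cvgD; exact: cvgS.
apply: nearW => n; rewrite /series /= -big_split /=.
apply: ler_sum => i _; rewrite -mulrDr ler_pM2l ?invr_gt0 ?exprn_gt0//.
have := metric_triangle (x i) (y i) (z i).
have := @mdist_ge0 R _ (x i) (y i); have := @mdist_ge0 R _ (y i) (z i).
move: (mdist (x i) (y i)) (mdist (y i) (z i)) (mdist (x i) (z i)) => a b c.
move=> b0 a0 cab; rewrite ge_min; case: (leP a 1) => a1; last first.
  by rewrite lerDl le_min b0 ler01 orbT.
by case: (leP b 1) => b1; rewrite ?cab// lerDr a0 orbT.
Qed.

HB.instance Definition _ := Choice.on (seqspace E).
HB.instance Definition _ := isMetric.Build R (seqspace E)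
  seqdistxx seqdist_positivity seqdist_sym seqdist_triangle.

End seqdist_metric.

HB.instance Definition _ (R : realType) (E : completePMetricType R) :=
  isPointed.Build (seqspace E) (fun=> point).

Definition Cb (R : realType) (T : topologicalType) : set (T -> R) :=
  [set f | continuous f /\ bounded_fun f].

Section rba.
Context (R : realType) (T : ptopologicalType).

(* The value outside the Borel sets is fixed to 0 so that two elements of rba
   are equal as soon as they agree on Borel sets. *)
Record is_rba (mu : set T -> R^o) : Prop := IsRba {
  rba_nonmeasurable : forall A : set (borel T), ~ measurable A -> mu A = 0 ;
  rba_additive : forall A B : set (borel T), measurable A -> measurable B ->
    A `&` B = set0 -> mu (A `|` B) = mu A + mu B ;
  rba_bounded : exists M : R,
    forall A : set (borel T), measurable A -> `|mu A| <= M ;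
  rba_regular : forall (A : set (borel T)) (e : R), measurable A -> 0 < e ->
    exists F O : set T, [/\ closed F, open O, F `<=` A, A `<=` O &
      forall C : set (borel T), measurable C -> C `<=` O `\` F -> `|mu C| < e]
}.

Definition rba_pred : {pred set T -> R^o} := fun mu => `[< is_rba mu >].

Lemma rba_submod_closed : submod_closed rba_pred.
Proof.
split=> [|k mu nu].
  apply/asboolP; split => //.
  - by move=> A B _ _ _; exact: (esym (addr0 (0 : R))).
  - by exists 0 => A _; rewrite (_ : _ A = 0 :> R)// normr0.
  - move=> A e mA e0.
    exists set0, setT; split=> //; [exact: closed0|exact: openT|].
    by move=> C _ _; rewrite (_ : _ C = 0 :> R)// normr0.
move=> /asboolP[mu0 muD [M muM] muR] /asboolP[nu0 nuD [N nuN] nuR].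
have E A : (k *: mu + nu) A = k * mu A + nu A by [].
apply/asboolP; split.
- by move=> A mA; rewrite E mu0// nu0// mulr0 addr0.
- by move=> A B mA mB AB; rewrite !E muD// nuD// mulrDr addrACA.
- exists (`|k| * M + N) => A mA; rewrite E.
  rewrite (le_trans (ler_normD _ _))// lerD ?nuN//.
  by rewrite normrM ler_wpM2l ?muM.
- move=> A e mA e0.
  have k0 : 0 < `|k| + 1 by rewrite ltr_wpDl.
  have [| |F1 [U1 [cF1 oU1 F1A AU1 h1]]] := muR A (e / 2 / (`|k| + 1)).
  + by [].
  + by rewrite !divr_gt0.
  have [| |F2 [U2 [cF2 oU2 F2A AU2 h2]]] := nuR A (e / 2).
  + by [].
  + by rewrite divr_gt0.
  exists (F1 `|` F2), (U1 `&` U2); split.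
  + exact: closedU.
  + exact: openI.
  + by rewrite subUset.
  + by rewrite subsetI.
  move=> C mC CU; rewrite E (le_lt_trans (ler_normD _ _))//.
  have C1 : `|mu C| < e / 2 / (`|k| + 1).
    by apply: h1 => // x /CU [[U1x U2x] nF]; split=> // F1x; apply: nF; left.
  have C2 : `|nu C| < e / 2.
    by apply: h2 => // x /CU [[U1x U2x] nF]; split=> // F2x; apply: nF; right.
  rewrite [ltRHS]splitr; apply: ler_ltD => //.
  rewrite normrM (@le_trans _ _ (`|k| * (e / 2 / (`|k| + 1))))//.
    by rewrite ler_wpM2l// ltW.
  rewrite mulrCA ger_pMr ?divr_gt0// ler_pdivrMr// mul1r.
  by rewrite lerDl.
Qed.

HB.instance Definition _ :=
  GRing.isSubmodClosed.Build R (set T -> R^o) rba_pred rba_submod_closed.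

Record rba : Type := Rba {
  rba_fun :> set T -> R^o ;
  rba_funP : rba_fun \in rba_pred }.

HB.instance Definition _ := [isSub for rba_fun].
HB.instance Definition _ := [Choice of rba by <:].
HB.instance Definition _ := [SubChoice_isSubLmodule of rba by <:].

Import HBSimple.

Definition simple_integral (mu : rba) (s : {sfun (borel T) >-> R}) : R :=
  \sum_(y \in range s) y * mu (s @^-1` [set y]).

(* The integral against a finitely additive measure: the limit of the
   integrals of simple functions that converge uniformly to f. *)
Definition has_integral (mu : rba) (f : T -> R) (I : R) : Prop :=
  forall e : R, 0 < e -> exists2 d : R, 0 < d &
    forall s : {sfun (borel T) >-> R},
      (forall x, `|f x - s x| <= d) -> `|simple_integral mu s - I| <= e.

Definition pairing (mu : rba) (f : T -> R) : R := get (has_integral mu f).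

(* The weak-* topology: the coarsest one that makes all the maps
   [pairing ^~ f], with f in C_b, continuous. *)
Definition eval_Cb (mu : rba) :
    prod_topology (fun _ : set_type (@Cb R T) => R : topologicalType) :=
  fun f => pairing mu (val f).

HB.instance Definition _ := Topological.copy rba (initial_topology eval_Cb).

Definition M1a : set rba :=
  [set mu | pairing mu (cst 1) = 1 /\
    forall f : T -> R, Cb f -> (forall x, 0 <= f x) -> 0 <= pairing mu f].

End rba.
Arguments rba : clear implicits.

Section thermodynamics.
Context (R : realType) (E : completePMetricType R).
Context (p : probability (borel E) R) (alpha : R).
Local Notation X := (seqspace E).

Definition Msigma : set (rba R X) :=
  [set mu | M1a mu /\
    forall f : X -> R, Cb f -> pairing mu (f \o @shift E) = pairing mu f].

Definition Dalpha (f : X -> R) : \bar R :=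
  ereal_sup [set r | exists x y : X,
    x != y /\ r = (`|f x - f y| / (mdist x y) `^ alpha)%:E].

Definition Hol : set (X -> R) := [set f | Cb f /\ (Dalpha f < +oo)%E].

Definition ruelle (f phi : X -> R) (x : X) : R :=
  \int[p]_a (expR (f (scons a x)) * phi (scons a x)).

(* nu is an eigenmeasure of the dual operator: L_g^* nu = lam nu, both sides
   being regarded as functionals on C_b. *)
Definition dual_eigen (g : X -> R) (nu : probability (borel X) R) (lam : R) :
    Prop :=
  forall phi : X -> R, Cb phi ->
    \int[nu]_x ruelle g phi x = lam * \int[nu]_x phi x.

(* For g in Hol there is exactly one such lam. *)
Definition lambda (g : X -> R) : R :=
  get [set lam | 0 < lam /\
    exists nu : probability (borel X) R, dual_eigen g nu lam].

Definition hv (mu : rba R X) : \bar R :=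
  ereal_inf [set (- pairing mu g + ln (lambda g))%:E | g in Hol].

Definition pressure (f : X -> R) : \bar R :=
  ereal_sup [set (hv mu + (pairing mu f)%:E)%E | mu in Msigma].

Definition equilibrium (f : X -> R) : set (rba R X) :=
  [set mu | Msigma mu /\ (hv mu + (pairing mu f)%:E)%E = pressure f].

End thermodynamics.
Arguments Msigma {R E}.

(* Main.v *)
Require Import Defs.
From HB Require Import structures.
From mathcomp Require Import all_boot all_order all_algebra.
From mathcomp Require Import all_classical all_reals all_analysis.
From mathcomp Require Import measurable_realfun ring lra.

(** The defining equation of an equilibrium state [mu] is
    [hv mu + mu(f) = P], with [P] the pressure of [f], and [hv mu] is the infimum
    of [- mu(g) + ln (lambda g)] over the Hoelder potentials [g].  As soon as [P]
    is known to be finite, [Eq(f)] is therefore the part of [Msigma] cut out by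
    the inequalities [P <= - mu(g) + ln (lambda g) + mu(f)] ([equilibriumP]).
    Each of them is affine and weak-* continuous in [mu].  Convexity follows
    from the linearity of the pairing in the measure ([pairing_linear]).

    For compactness, take an ultrafilter on [Eq(f)].  The pairings with a fixed
    function of [Cb] are bounded, so they converge, and their limit is a positive
    normalised functional [L] that inherits the shift invariance and all the
    inequalities.  It remains to find an element of [rba] with pairing [L].  This
    is where the entropy enters.  For the potential [g = C * bump(x_0)], where
    [bump] vanishes on a finite set and equals [1] away from a neighbourhood of
    it, the eigenvalue is the integral of [exp (C * bump)] against [p].  For a
    finite set that nearly exhausts [p] this is at most [2] even for a large [C],
    and the inequality for [g] makes [mu(bump(x_0))] small, uniformly in [mu]
    ([equilibrium_tight]).  So [L] is tight.  On the complete space [E] a tight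
    functional satisfies the Daniell condition ([tight_daniell]), hence is the
    integral of an outer regular countably additive probability
    ([daniell_representation]), which is an element of [rba]
    ([tight_representation]).

    The finiteness of [P] needs a member of [Msigma] of entropy larger than
    [-oo], and it needs [lambda g] to be an eigenvalue for every [g], because it
    is only a chosen value.  Both come from the operator [Q = ruelle p g].
    Bounded distortion makes [Q^n 1] comparable with [lam^n] for some [lam > 0],
    and a limit of the Cesaro means of [lam^(-n) Q^n] at a base point is an
    eigenfunctional ([eigenstate_exists]); comparing [Q] with the average over
    [p] shows that it is tight, so it is an eigenmeasure ([lambda_spec]).  For
    [g = 0] the result is shift-invariant, and Jensen's inequality bounds its
    integral of [g] by [ln (lambda g)] ([stationary_le_ln_lambda]), so that its
    entropy is nonnegative. *)

Set Implicit Arguments.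
Unset Strict Implicit.
Unset Printing Implicit Defensive.

Import Order.TTheory GRing.Theory Num.Theory.
Import numFieldNormedType.Exports.
Import HBSimple.
Local Open Scope classical_set_scope.
Local Open Scope ring_scope.

(** * Bounded continuous functions and states *)

Section bounded_continuous.
Context (R : realType) (T : topologicalType).
Implicit Types f g : T -> R.

Lemma CbP f : Cb f <-> continuous f /\ exists M, forall x, `|f x| <= M.
Proof.
split=> -[cf]; last first.
  case=> M fM; split=> //; exists M; split; first exact: num_real.
  by move=> N MN x _ /=; rewrite (le_trans (fM x)) ?ltW.
case=> M [_ fM]; split=> //; exists (M + 1) => x.
by apply: fM => //; rewrite ltrDl.
Qed.

Lemma Cb_continuous f : Cb f -> continuous f.
Proof. by case. Qed.

Lemma Cb_bound f : Cb f -> exists2 M, 0 <= M & forall x, `|f x| <= M.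
Proof.
move=> /CbP[_ [M fM]]; exists (Num.max 0 M); first by rewrite le_max lexx.
by move=> x; rewrite le_max fM orbT.
Qed.

Lemma Cb_cst (k : R) : Cb (fun _ : T => k).
Proof. by apply/CbP; split; [move=> x; exact: cvg_cst|exists `|k|]. Qed.

Lemma CbD f g : Cb f -> Cb g -> Cb (fun x => f x + g x).
Proof.
move=> /CbP[cf [M fM]] /CbP[cg [N gN]]; apply/CbP; split.
  by move=> x; apply: cvgD; [exact: cf|exact: cg].
by exists (M + N) => x; rewrite (le_trans (ler_normD _ _))// lerD.
Qed.

Lemma CbM f g : Cb f -> Cb g -> Cb (fun x => f x * g x).
Proof.
move=> /CbP[cf [M fM]] /CbP[cg [N gN]]; apply/CbP; split.
  by move=> x; apply: cvgM; [exact: cf|exact: cg].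
by exists (M * N) => x; rewrite normrM ler_pM.
Qed.

Lemma CbZ k f : Cb f -> Cb (fun x => k * f x).
Proof. by move=> cf; apply: CbM => //; exact: Cb_cst. Qed.

Lemma CbN f : Cb f -> Cb (fun x => - f x).
Proof.
move=> /(CbZ (-1)).
by rewrite (_ : (fun x => -1 * _ x) = fun x => - f x)//;
  apply/funext => x; rewrite mulN1r.
Qed.

Lemma CbB f g : Cb f -> Cb g -> Cb (fun x => f x - g x).
Proof. by move=> cf /CbN; exact: CbD. Qed.

Lemma Cb_sum (I : Type) (r : seq I) (P : pred I) (F : I -> T -> R) :
  (forall i, Cb (F i)) -> Cb (fun x => \sum_(i <- r | P i) F i x).
Proof.
move=> cF; elim: r => [|i r IH].
  rewrite (_ : (fun _ => _) = fun=> 0); first exact: Cb_cst.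
  by apply/funext => x; rewrite big_nil.
rewrite (_ : (fun _ => _) = fun x => (if P i then F i x else 0) +
    \sum_(j <- r | P j) F j x).
  by apply: CbD => //; case: (P i) => //; exact: Cb_cst.
by apply/funext => x; rewrite big_cons; case: ifP; rewrite ?add0r.
Qed.

Lemma Cb_norm f : Cb f -> Cb (fun x => `|f x|).
Proof.
move=> /CbP[cf [M fM]]; apply/CbP; split.
  by move=> x; apply: cvg_norm; exact: cf.
by exists M => x; rewrite normr_id.
Qed.

Lemma Cb_min f g : Cb f -> Cb g -> Cb (fun x => Num.min (f x) (g x)).
Proof.
move=> cf cg.
rewrite (_ : (fun _ => _) = (fun x => 2^-1 * (f x + g x - `|f x - g x|))).
  by apply: CbZ; apply: CbB; [exact: CbD|apply: Cb_norm; exact: CbB].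
by apply/funext => x; rewrite minr_absE mulrC.
Qed.

Lemma Cb_exp f : Cb f -> Cb (fun x => expR (f x)).
Proof.
move=> /CbP[cf [M fM]]; apply/CbP; split.
  move=> x; apply: (@continuous_comp _ _ _ f (@expR R)); first exact: cf.
  exact: continuous_expR.
exists (expR M) => x; rewrite ger0_norm ?expR_ge0// ler_expR.
by rewrite (le_trans _ (fM x))// ler_norm.
Qed.

End bounded_continuous.

Lemma Cb_comp (R : realType) (S T : topologicalType) (f : T -> R) (h : S -> T) :
  Cb f -> continuous h -> Cb (f \o h).
Proof.
move=> /CbP[cf [M fM]] ch; apply/CbP; split; last by exists M => x; exact: fM.
by move=> x; apply: continuous_comp; [exact: ch|exact: cf].
Qed.

(** Integrals against finitely additive probabilities are of this form, and so
    are their pointwise limits, which are not yet known to be integrals. *)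
Record state (R : realType) (T : topologicalType) (L : (T -> R) -> R) : Prop :=
  State {
    stateD : forall f g, Cb f -> Cb g -> L (fun x => f x + g x) = L f + L g ;
    stateZ : forall k f, Cb f -> L (fun x => k * f x) = k * L f ;
    state_ge0 : forall f, Cb f -> (forall x, 0 <= f x) -> 0 <= L f ;
    state1 : L (fun=> 1) = 1
  }.

Section state_theory.
Context (R : realType) (T : topologicalType) (L : (T -> R) -> R).
Hypothesis stL : state L.
Implicit Types f g : T -> R.

Lemma state_cst k : L (fun=> k) = k.
Proof.
have := stateZ stL k (@Cb_cst R T 1).
by rewrite (state1 stL) mulr1.
Qed.

Lemma stateN f : Cb f -> L (fun x => - f x) = - L f.
Proof.
move=> cf; have := stateZ stL (-1) cf; rewrite mulN1r => <-.
by congr L; apply/funext => x; rewrite mulN1r.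
Qed.

Lemma stateB f g : Cb f -> Cb g -> L (fun x => f x - g x) = L f - L g.
Proof. by move=> cf cg; rewrite -stateN// -(stateD stL)//; exact: CbN. Qed.

Lemma state_le f g : Cb f -> Cb g -> (forall x, f x <= g x) -> L f <= L g.
Proof.
move=> cf cg fg; rewrite -subr_ge0 -stateB//; apply: state_ge0 => //.
  exact: CbB.
by move=> x; rewrite subr_ge0.
Qed.

Lemma state_ubound f M : Cb f -> (forall x, f x <= M) -> L f <= M.
Proof.
by move=> cf fM; rewrite -(state_cst M) state_le//; exact: Cb_cst.
Qed.

Lemma state_lbound f M : Cb f -> (forall x, M <= f x) -> M <= L f.
Proof.
by move=> cf fM; rewrite -(state_cst M) state_le//; exact: Cb_cst.
Qed.

Lemma state_norm f M : Cb f -> (forall x, `|f x| <= M) -> `|L f| <= M.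
Proof.
move=> cf fM; rewrite ler_norml; apply/andP; split.
  by apply: state_lbound => // x; have := fM x; rewrite ler_norml => /andP[].
by apply: state_ubound => // x; have := fM x; rewrite ler_norml => /andP[].
Qed.

Lemma state_sum (I : Type) (r : seq I) (P : pred I) (F : I -> T -> R) :
  (forall i, Cb (F i)) ->
  L (fun x => \sum_(i <- r | P i) F i x) = \sum_(i <- r | P i) L (F i).
Proof.
move=> cF; elim: r => [|i r IH].
  rewrite (_ : (fun _ => _) = fun=> 0) ?state_cst ?big_nil//.
  by apply/funext => x; rewrite big_nil.
rewrite (_ : (fun _ => _) = fun x => (if P i then F i x else 0) +
    \sum_(j <- r | P j) F j x); last first.
  by apply/funext => x; rewrite big_cons; case: ifP; rewrite ?add0r.
rewrite big_cons; case: (P i).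
  by rewrite (stateD stL) ?IH//; exact: Cb_sum.
by rewrite -IH; congr L; apply/funext => x; rewrite add0r.
Qed.

End state_theory.

(** * Integration of bounded continuous functions *)

Section borel_integration.
Context (R : realType) (T : ptopologicalType).

Lemma borel_open (O : set T) : open O -> measurable (O : set (borel T)).
Proof. exact: sub_sigma_algebra. Qed.

Lemma continuous_borel (f : T -> R) : continuous f ->
  measurable_fun setT (f : borel T -> R).
Proof.
move=> cf; apply: (measurability _ (RGenOInfty.measurableE R)) => A [_ [x ->] <-].
rewrite setTI; apply: borel_open; apply: open_comp; last exact: rray_open.
by move=> t _; exact: cf.
Qed.

Variable nu : probability (borel T) R.

Lemma bounded_integrable (f : T -> R) M : measurable_fun setT (f : borel T -> R) ->
  (forall x, `|f x| <= M) -> nu.-integrable setT (EFin \o f).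
Proof.
move=> mf fM; apply: (@measurable_bounded_integrable _ (borel T) R nu) => //.
- by rewrite (le_lt_trans (probability_le1 _ _))// ltry.
- exists M; split; first exact: num_real.
  by move=> N MN x _ /=; rewrite (le_trans (fM x)) ?ltW.
Qed.

Lemma Cb_integrable (f : T -> R) : Cb f -> nu.-integrable setT (EFin \o f).
Proof.
move=> /CbP[cf [M fM]]; apply: bounded_integrable fM.
exact: continuous_borel.
Qed.

Lemma state_integral : state (fun f : T -> R => \int[nu]_x f x).
Proof.
split.
- by move=> f g cf cg; apply: RintegralD => //; exact: Cb_integrable.
- by move=> k f cf; apply: RintegralZl => //; exact: Cb_integrable.
- by move=> f cf f0; apply: Rintegral_ge0.
- rewrite Rintegral_cst// mul1r (_ : fine _ = fine 1%E)//.
  by congr fine; exact: probability_setT.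
Qed.

Lemma Cb_dominated (f_ : nat -> T -> R) (f : T -> R) M :
  (forall n, Cb (f_ n)) -> Cb f -> (forall n x, `|f_ n x| <= M) ->
  (forall x, f_ n x @[n --> \oo] --> f x) ->
  \int[nu]_x f_ n x @[n --> \oo] --> \int[nu]_x f x.
Proof.
move=> cf_ cf fM ff.
have [_ _ h] := @dominated_convergence _ (borel T) R nu setT measurableT
  (fun n => EFin \o f_ n) (EFin \o f) (cst M%:E)
  (fun n => measurable_int _ (Cb_integrable (cf_ n)))
  (measurable_int _ (Cb_integrable cf))
  ltac:(by apply: aeW => x _; apply: cvg_EFin; [exact: nearW|exact: ff])
  ltac:(by apply: (@bounded_integrable (cst M) `|M|))
  ltac:(by apply: aeW => x n _; rewrite /= lee_fin fM).
have E g : Cb g -> (\int[nu]_x (EFin \o g) x)%E = (\int[nu]_x g x)%:E.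
  move=> cg; rewrite /Rintegral fineK//.
  by apply: integrable_fin_num => //; exact: Cb_integrable.
by rewrite E// in h; exact: fine_cvg h.
Qed.
End borel_integration.

(** * The Daniell-Riesz representation *)

(** Sequential continuity from above at [0], written without limits: this is
    what distinguishes countably additive states. *)
Definition daniell (R : realType) (T : topologicalType) (L : (T -> R) -> R) :=
  forall f_ : nat -> T -> R, (forall n, Cb (f_ n)) ->
    (forall n x, 0 <= f_ n x) -> (forall n x, f_ n.+1 x <= f_ n x) ->
    (forall x e, 0 < e -> exists n, f_ n x <= e) ->
  forall e, 0 < e -> exists n, L (f_ n) <= e.

(** The form of perfect normality that is used: the indicator of an open set is
    the increasing limit of the functions [min(1, n psi)]. *)
Definition cozero_opens (R : realType) (T : topologicalType) :=
  forall O : set T, open O -> exists psi : T -> R,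
    [/\ Cb psi, forall x, 0 <= psi x & forall x, O x <-> 0 < psi x].

Section representation.
Context (R : realType) (T : ptopologicalType) (L : (T -> R) -> R).
Hypotheses (stL : state L) (dL : daniell L) (cozero : cozero_opens R T).

Definition below (O : set T) : set (T -> R) :=
  [set f | [/\ Cb f, forall x, 0 <= f x <= 1 & forall x, ~ O x -> f x = 0]].

Definition tau (O : set T) : \bar R := ereal_sup [set (L f)%:E | f in below O].

(** [tau] is what the measure of an open set has to be, and [tau_outer] the
    outer measure that it forces by outer regularity. *)
Definition tau_outer (A : set T) : \bar R :=
  ereal_inf [set tau O | O in [set O | open O /\ A `<=` O]].

Lemma below_tau O f : below O f -> ((L f)%:E <= tau O)%E.
Proof. by move=> Of; apply: ereal_sup_ubound; exists f. Qed.

Lemma tau_ge0 O : (0 <= tau O)%E.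
Proof.
apply: le_trans (@below_tau O (fun=> 0) _); first by rewrite (state_cst stL).
by split=> // [|x]; [exact: Cb_cst|rewrite lexx ler01].
Qed.

Lemma tau_le1 O : (tau O <= 1)%E.
Proof.
apply: ge_ereal_sup => _ [f [cf f01 _] <-]; rewrite lee_fin.
by apply: (state_ubound stL) => // x; case/andP: (f01 x).
Qed.

Lemma tau_fin O : tau O \is a fin_num.
Proof.
by rewrite ge0_fin_numE ?tau_ge0// (le_lt_trans (tau_le1 O))// ltry.
Qed.

Lemma le_tau O O' : O `<=` O' -> (tau O <= tau O')%E.
Proof.
move=> OO'; apply: ereal_sup_le => _ [f [cf f01 f0] <-]; exists f => //.
by split=> // x nO'; apply: f0 => /OO'.
Qed.

Lemma tau0 : tau set0 = 0%E.
Proof.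
apply/eqP; rewrite eq_le tau_ge0 andbT; apply: ge_ereal_sup.
move=> _ [f [cf _ f0] <-]; rewrite (_ : f = fun=> 0) ?(state_cst stL)//.
by apply/funext => x; exact: f0.
Qed.

Lemma tau_outer_open O : open O -> tau_outer O = tau O.
Proof.
move=> oO; apply/eqP; rewrite eq_le; apply/andP; split.
  by apply: ereal_inf_lbound; exists O => //=; split.
by apply: le_ereal_inf_tmp => _ [U [_ OU] <-]; exact: le_tau.
Qed.

Lemma tau_outer_ge0 A : (0 <= tau_outer A)%E.
Proof. by apply: le_ereal_inf_tmp => _ [U [_ _] <-]; exact: tau_ge0. Qed.

Lemma tau_outer_le1 A : (tau_outer A <= 1)%E.
Proof.
apply: le_trans (tau_le1 setT); apply: ereal_inf_lbound; exists setT => //.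
by split => //; exact: openT.
Qed.

Lemma tau_outer_fin A : tau_outer A \is a fin_num.
Proof.
by rewrite ge0_fin_numE ?tau_outer_ge0// (le_lt_trans (tau_outer_le1 A))// ltry.
Qed.

Lemma le_tau_outer A B : A `<=` B -> (tau_outer A <= tau_outer B)%E.
Proof.
move=> AB; apply: ereal_inf_le_tmp => _ [U [oU BU] <-]; exists U => //.
by split=> //; exact: subset_trans BU.
Qed.

Lemma tau_outer_adherent A (e : R) : 0 < e ->
  exists O, [/\ open O, A `<=` O & (tau O <= tau_outer A + e%:E)%E].
Proof.
move=> e0; have [_ [ O [oO AO] <-] lt] := lb_ereal_inf_adherent e0 (tau_outer_fin A).
by exists O; split => //; exact: ltW.
Qed.

(** If [psi_n] vanishes exactly off [O_n], the functions
    [sum_(n < N) min(1, N psi_n)] grow beyond [1] at each point of the union,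
    so that the Daniell property bounds [L f] by the values on the pieces. *)
Lemma tau_bigcup (O : set T) (O_ : nat -> set T) : (forall n, open (O_ n)) ->
  O `<=` \bigcup_n O_ n -> (tau O <= \sum_(n <oo) tau (O_ n))%E.
Proof.
move=> oO OO; apply: ge_ereal_sup => _ [f [cf f01 f0] <-].
have /choice[psi psiP] n := cozero (oO n).
have cpsi n : Cb (psi n) by case: (psiP n).
have psi0 n x : 0 <= psi n x by case: (psiP n).
pose g N n x := Num.min 1 (N%:R * psi n x).
have cg N n : Cb (g N n) by apply: Cb_min; [exact: Cb_cst|exact: CbZ].
have g0 N n x : 0 <= g N n x by rewrite le_min ler01 mulr_ge0.
pose h N x := \sum_(n < N) g N n x.
have ch N : Cb (h N) by exact: Cb_sum.
pose u N x := f x - Num.min (f x) (h N x).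
have cu N : Cb (u N) by apply: CbB => //; exact: Cb_min.
have h_homo N x : h N x <= h N.+1 x.
  rewrite /h big_ord_recr/= -[leLHS]addr0 lerD//; apply: ler_sum => n _.
  rewrite /g le_min ge_min lexx/= ge_min; apply/orP; right.
  by rewrite ler_wpM2r// ler_nat.
apply/lee_addgt0Pr => e e0.
have [||x d d0|N uN] := dL cu _ _ _ e0.
- by move=> n x; rewrite subr_ge0 ge_min lexx.
- move=> n x; rewrite lerD2l lerN2 le_min ge_min lexx/= ge_min.
  by rewrite h_homo orbT.
- have [Ox|nOx] := pselect (O x); last first.
    exists 0%N; rewrite /u f0// /h big_ord0 minxx subrr; exact: ltW.
  have [n _ Onx] := OO x Ox.
  have px : 0 < psi n x by case: (psiP n) => _ _ /(_ x)[+ _]; exact.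
  (* [n < N] puts the [n]-th term into the sum, [1 / psi n x <= N] makes it 1. *)
  pose N := maxn n.+1 (Num.truncn (psi n x)^-1).+1.
  exists N; rewrite /u min_l ?subrr ?(ltW d0)//.
  case/andP: (f01 x) => _ /le_trans; apply.
  have nN : (n < N)%N by rewrite leq_max ltnSn.
  rewrite /h (bigD1 (Ordinal nN))//= ler_wpDr ?sumr_ge0//.
  rewrite /g le_min lexx/= -ler_pdivrMr// div1r.
  apply: (@le_trans _ _ (Num.truncn (psi n x)^-1).+1%:R).
    by apply: ltW; exact: truncnS_gt.
  by rewrite ler_nat leq_max leqnn orbT.
have Lf : L f <= e + \sum_(n < N) L (g N n).
  have <- : L (h N) = \sum_(n < N) L (g N n) by exact: state_sum.
  rewrite -lerBlDr.
  apply: (le_trans _ uN); rewrite (stateB stL)//; last exact: Cb_min.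
  rewrite lerD2l lerN2; apply: (state_le stL) => //; first exact: Cb_min.
  by move=> x; rewrite ge_min lexx orbT.
apply: (@le_trans _ _ (e + \sum_(n < N) L (g N n))%:E); first by rewrite lee_fin.
rewrite EFinD addeC leeD2r// -sumEFin.
apply: (@le_trans _ _ (\sum_(0 <= n < N) tau (O_ n))%E).
  rewrite big_mkord; apply: lee_sum => n _; apply: below_tau; split => //.
    by move=> x; rewrite g0/= ge_min lexx.
  move=> x nO; rewrite /g (_ : psi n x = 0) ?mulr0 ?min_r//.
  apply/eqP; rewrite eq_le psi0 andbT leNgt; apply/negP => px; apply: nO.
  by case: (psiP n) => _ _ /(_ x)[_]; apply.
by apply: nneseries_lim_ge => n _ _; exact: tau_ge0.
Qed.

Lemma tau_outer0 : tau_outer set0 = 0%E.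
Proof. by rewrite tau_outer_open ?tau0//; exact: open0. Qed.

Lemma tau_outer_sigma_subadditive : sigma_subadditive tau_outer.
Proof.
move=> F; apply/lee_addgt0Pr => e e0.
apply: le_trans (epsilon_trick _ _ (ltW e0)); last first.
  by move=> n; exact: tau_outer_ge0.
have eVn_gt0 n : 0 < e / (2 ^ n.+1)%:R by rewrite divr_gt0// ltr0n expn_gt0.
have /choice[U_ UP] n := tau_outer_adherent (F n) (eVn_gt0 n).
apply: (@le_trans _ _ (tau (\bigcup_n U_ n))).
  apply: ereal_inf_lbound; exists (\bigcup_n U_ n) => //; split.
    by apply: bigcup_open => n _; case: (UP n).
  by apply: subset_bigcup => n _; case: (UP n).
apply: (@le_trans _ _ (\sum_(n <oo) tau (U_ n))%E).
  by apply: tau_bigcup => // n; case: (UP n).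
apply: lee_nneseries => n _; first by move=> _; exact: tau_ge0.
by case: (UP n).
Qed.

HB.instance Definition _ := isOuterMeasure.Build R T tau_outer tau_outer0
  tau_outer_ge0 le_tau_outer tau_outer_sigma_subadditive.

(** Given [f] below [O `&` U] with [L f] almost [tau (O `&` U)], the part of
    [O] where [f < e] is an open set containing [O `\` U]; a function [g] below
    it can be added to [f], up to the factor [1 - e]. *)
Lemma open_caratheodory U : open U -> tau_outer.-caratheodory U.
Proof.
move=> oU; apply: le_caratheodory_measurable => A.
apply: le_ereal_inf_tmp => _ [ O [oO AO] <-].
have oOU : open (O `&` U) by exact: openI.
apply: (@le_trans _ _ (tau (O `&` U) + tau_outer (O `&` ~` U))%E).
  apply: leeD; last by apply: le_tau_outer; exact: setSI.
  by rewrite -tau_outer_open//; apply: le_tau_outer; exact: setSI.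
rewrite -(fineK (tau_fin _)) -(fineK (tau_outer_fin _)) -(fineK (tau_fin O)).
rewrite -EFinD lee_fin.
(* The additivity inequality up to [e], the factor [1 - e] being removed below. *)
have key (e : R) : 0 < e -> e < 1 ->
    fine (tau (O `&` U)) + (1 - e) * fine (tau_outer (O `&` ~` U)) <=
    fine (tau O) + e.
  move=> e0 e1.
  have [_ [f [cf f01 f0] <-]] := ub_ereal_sup_adherent e0 (tau_fin (O `&` U)).
  rewrite -/(tau _) => fe.
  pose V := O `&` [set x | f x < e].
  have oV : open V.
    apply: openI => //; apply: (@open_comp _ _ f [set y | y < e]).
      by move=> x _; exact: Cb_continuous.
    exact: open_lt.
  have VO : (tau_outer (O `&` ~` U) <= tau V)%E.
    apply: ereal_inf_lbound; exists V => //; split=> // x [Ox nU]; split=> //=.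
    by rewrite f0// => -[].
  have Vle : ((1 - e)%:E * tau V <= (fine (tau O) - L f)%:E)%E.
    rewrite -(fineK (tau_fin V)) -EFinM lee_fin mulrC -ler_pdivlMr ?subr_gt0//.
    rewrite -lee_fin fineK ?tau_fin//.
    apply: ge_ereal_sup => _ [g [cg g01 g0] <-]; rewrite lee_fin.
    rewrite ler_pdivlMr ?subr_gt0// mulrC lerBrDr addrC.
    rewrite -(stateZ stL)// -(stateD stL)//; last exact: CbZ.
    rewrite -lee_fin fineK ?tau_fin//; apply: below_tau; split.
    - by apply: CbD => //; exact: CbZ.
    - move=> x; case/andP: (f01 x) => fx0 fx1; case/andP: (g01 x) => gx0 gx1.
      apply/andP; split; first by rewrite addr_ge0// mulr_ge0// subr_ge0 ltW.
      have [[_ /= fxe]|nV] := pselect (V x); first by nra.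
      by rewrite g0// mulr0 addr0.
    - move=> x nO; rewrite f0; last by case.
      by rewrite g0 ?mulr0 ?addr0//; case.
  move: fe VO Vle; rewrite -(fineK (tau_fin (O `&` U))).
  rewrite -(fineK (tau_outer_fin _)) -(fineK (tau_fin V)) -EFinM -EFinB.
  rewrite !lee_fin lte_fin /= => h1 h2 h3; nra.
move: key (tau_outer_ge0 (O `&` ~` U)) (tau_outer_le1 (O `&` ~` U)).
rewrite -(fineK (tau_outer_fin _)) !lee_fin /=.
move: (fine _) (fine _) (fine _) => a b c key b0 b1.
apply/ler_addgt0Pr => e e0.
pose d := Num.min (e / 2) 2^-1.
have d0 : 0 < d by rewrite lt_min divr_gt0// invr_gt0 ltr0n.
have dlt1 : d < 1 by rewrite gt_min invf_lt1 ?ltr1n ?orbT.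
have de : d <= e / 2 by rewrite ge_min lexx.
have := key d d0 dlt1; nra.
Qed.

Lemma borel_caratheodory (A : set (borel T)) : measurable A ->
  tau_outer.-caratheodory A.
Proof.
move: A; apply: smallest_sub => //; last exact: open_caratheodory.
split.
- exact: caratheodory_measurable_set0.
- by move=> A mA; rewrite setTD; exact: caratheodory_measurable_setC.
- by move=> F mF; exact: caratheodory_measurable_bigcup.
Qed.


Let nu : set (borel T) -> \bar R := tau_outer.

Let nu0 : nu set0 = 0%E. Proof. exact: tau_outer0. Qed.

Let nu_ge0 A : (0 <= nu A)%E. Proof. exact: tau_outer_ge0. Qed.

Let nu_sigma_additive : semi_sigma_additive nu.
Proof.
move=> F mF tF mUF.
have cF n : tau_outer.-cara.-measurable (F n) by exact: borel_caratheodory.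
apply: (@caratheodory_measure_sigma_additive _ _ tau_outer) => //.
exact: borel_caratheodory.
Qed.

HB.instance Definition _ :=
  isMeasure.Build _ _ _ nu nu0 nu_ge0 nu_sigma_additive.

Let nuT : nu setT = 1%E.
Proof.
rewrite /nu tau_outer_open; last exact: openT.
apply/eqP; rewrite eq_le tau_le1/= -(state1 stL); apply: below_tau.
split=> [|x|x /(_ I)//]; first exact: Cb_cst.
by rewrite lexx ler01.
Qed.

HB.instance Definition _ := Measure_isProbability.Build _ _ _ nu nuT.

Lemma indicator_Rintegral (P : probability (borel T) R) (A : set (borel T))
    (f : T -> R) : measurable A -> Cb f -> (forall x, 0 <= f x) ->
  (forall x, A x -> 1 <= f x) -> fine (P A) <= \int[P]_x f x.
Proof.
move=> mA cf f0 f1.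
rewrite [leLHS](_ : _ = \int[P]_x (\1_A x : R)); last first.
  by rewrite /Rintegral integral_indic// setIT.
apply: le_Rintegral => //; last 2 first.
- exact: Cb_integrable.
- move=> x _; rewrite indicE; case: (boolP (x \in A)) => [/set_mem/f1//|_].
  exact: f0.
apply: (@bounded_integrable _ _ _ _ 1); first exact: measurable_indic.
by move=> x; rewrite indicE; case: (x \in A); rewrite ?normr1// normr0.
Qed.

(** A layer-cake estimate: [f] is cut into [n] slices of height [1 / n], the
    [i]-th one being comparable with the indicator of [f > i / n]. *)
Let le_integral01 (f : T -> R) : Cb f -> (forall x, 0 <= f x <= 1) ->
  L f <= \int[nu]_x f x.
Proof.
move=> cf f01; apply/ler_addgt0Pr => e e0.
(* Enough slices for the error [1 / n] of the layer-cake sum to be below [e]. *)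
pose n := (Num.truncn e^-1).+1.
have n0 : 0 < n%:R :> R by rewrite ltr0n.
have ne : n%:R^-1 <= e.
  by rewrite invf_ple ?posrE// ltW// truncnS_gt.
clearbody n.
pose s i x := Num.min (f x) (i.+1%:R / n%:R) - Num.min (f x) (i%:R / n%:R).
have cs i : Cb (s i).
  by apply: CbB; apply: Cb_min => //; exact: Cb_cst.
have fE : f = fun x => \sum_(i < n) s i x.
  apply/funext => x; rewrite -(big_mkord xpredT (fun i => s i x)).
  rewrite /s telescope_sumr// mul0r divff ?gt_eqF//.
  by case/andP: (f01 x) => fx0 fx1; rewrite min_l// min_r// subr0.
have s_ge0 i x : 0 <= s i x.
  rewrite subr_ge0 le_min !ge_min lexx/= ler_pM2r ?invr_gt0// ler_nat.
  by rewrite leqnSn orbT.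
have s_le i x : s i x <= n%:R^-1.
  have : 0 <= n%:R^-1 :> R by rewrite invr_ge0 ltW.
  rewrite /s -[in i.+1%:R]addn1 natrD mulrDl mul1r.
  move: (f x) (n%:R^-1 : R) (i%:R / n%:R : R) => u w v w0.
  by case: (leP u (v + w)) => ?; case: (leP u v) => ?; lra.
pose lev i : set (borel T) := [set x | i%:R / n%:R < f x].
have olev i : open (lev i : set T).
  apply: (@open_comp _ _ f [set y | i%:R / n%:R < y]); last exact: open_gt.
  by move=> x _; exact: Cb_continuous.
have mlev i : measurable (lev i) by exact: borel_open.
pose a i := fine (nu (lev i)).
have up i : n%:R * L (s i) <= a i.
  rewrite -(stateZ stL)// -lee_fin fineK; last exact: tau_outer_fin.
  rewrite /nu tau_outer_open//; apply: below_tau; split.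
  - exact: CbZ.
  - move=> x; rewrite mulr_ge0//= -ler_pdivlMl// mulr1; exact: s_le.
  - move=> x /negP; rewrite -leNgt => fx; rewrite /s !min_l ?subrr ?mulr0//.
    by rewrite (le_trans fx)// ler_pM2r ?invr_gt0// ler_nat.
have down i : a i.+1 <= n%:R * \int[nu]_x s i x.
  have := stateZ (state_integral nu) n%:R (cs i) => /= <-.
  apply: indicator_Rintegral => //; first exact: CbZ.
    by move=> x; rewrite mulr_ge0.
  move=> x /= fx; rewrite -ler_pdivrMl// mulr1 /s min_r ?(ltW fx)//.
  rewrite min_r; last first.
    by rewrite (le_trans _ (ltW fx))// ler_pM2r ?invr_gt0// ler_nat.
  by rewrite -mulrBl -natrB ?leqnSn// subSnn mul1r.
have a01 i : 0 <= a i <= 1.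
  rewrite -!lee_fin fineK; last exact: tau_outer_fin.
  by rewrite tau_outer_ge0 tau_outer_le1.
have Lf : L f = \sum_(i < n) L (s i) by rewrite {1}fE (state_sum stL).
have If : \int[nu]_x f x = \sum_(i < n) \int[nu]_x s i x.
  by rewrite {1}fE (state_sum (state_integral nu)).
suff : n%:R * L f <= n%:R * (\int[nu]_x f x) + 1.
  by rewrite -ler_pdivlMl// => /le_trans; apply; rewrite mulrDr mulKf ?gt_eqF// mulr1 lerD2l.
rewrite Lf If !mulr_sumr.
apply: (@le_trans _ _ (\sum_(i < n) a i)); first by apply: ler_sum => i _.
apply: (@le_trans _ _ (\sum_(i < n) a i.+1 + 1)); last first.
  by rewrite lerD2r; apply: ler_sum => i _.
apply: (@le_trans _ _ (\sum_(i < n.+1) a i)).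
  by rewrite big_ord_recr/= lerDl; case/andP: (a01 n).
by rewrite big_ord_recl addrC lerD2l; case/andP: (a01 0%N).
Qed.

Let le_integral (f : T -> R) : Cb f -> L f <= \int[nu]_x f x.
Proof.
move=> cf; have [M M0 fM] := Cb_bound cf.
pose g x := (2 * (M + 1))^-1 * (f x + (M + 1)).
have M1 : 0 < 2 * (M + 1) by rewrite mulr_gt0// ltr_wpDl.
have cf1 : Cb (fun x => f x + (M + 1)) by apply: CbD => //; exact: Cb_cst.
have : L g <= \int[nu]_x g x.
  apply: le_integral01; first exact: CbZ.
  move=> x; have := fM x; rewrite ler_norml => /andP[h1 h2].
  rewrite /g mulr_ge0 ?invr_ge0 ?(ltW M1)//=; last by lra.
  by rewrite ler_pdivrMl// mulr1; lra.
rewrite /g (stateZ stL)//.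
have := stateZ (state_integral nu) (2 * (M + 1))^-1 cf1 => /= ->.
rewrite ler_pM2l ?invr_gt0//.
have ccst : Cb (fun _ : T => M + 1) by exact: Cb_cst.
rewrite (stateD stL cf ccst) (state_cst stL).
have := stateD (state_integral nu) cf ccst => /= ->.
by rewrite (state_cst (state_integral nu)) lerD2r.
Qed.

(** One inequality between the functional and the integral suffices: applied to
    [- f] it gives the other one. *)
Theorem daniell_representation : exists2 P : probability (borel T) R,
  forall f, Cb f -> L f = \int[P]_x f x &
  forall (A : set (borel T)) (e : R), 0 < e -> exists O : set (borel T),
    [/\ open (O : set T), A `<=` O & (P O <= P A + e%:E)%E].
Proof.
exists nu => [f cf|A e e0]; last first.
  have [ O [oO AO OA]] := tau_outer_adherent A e0; exists O; split => //.
  by rewrite /= /nu (tau_outer_open oO).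
apply/eqP; rewrite eq_le le_integral//= -lerN2 -(stateN stL)//.
have := stateN (state_integral nu) cf => /= <-.
by apply: le_integral; exact: CbN.
Qed.

End representation.

(** * The metric of the sequence space *)

Section metric_functions.
Context (R : realType) (M : metricType R).

Lemma metric_continuous (N : metricType R) (f : M -> N) :
  (forall x e, 0 < e -> exists2 d, 0 < d &
    forall y, mdist x y < d -> mdist (f x) (f y) < e) -> continuous f.
Proof.
move=> h x; apply/cvg_ballP => e e0; have [d d0 hd] := h x e e0.
by apply/nbhs_ballP; exists d => // y; rewrite !ballEmdist /=; exact: hd.
Qed.

Lemma lipschitz_continuous (N : metricType R) (C : R) (f : M -> N) :
  (forall x y, mdist (f x) (f y) <= C * mdist x y) -> continuous f.
Proof.
move=> fC; apply: metric_continuous => x e e0.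
have C0 : 0 < `|C| + 1 by rewrite ltr_wpDl.
exists (e / (`|C| + 1)); first exact: divr_gt0.
move=> y; rewrite ltr_pdivlMr// => xy.
apply: le_lt_trans xy; apply: (le_trans (fC x y)); rewrite mulrC.
by rewrite ler_wpM2l ?mdist_ge0// (le_trans (ler_norm C))// lerDl.
Qed.

Lemma lipschitz_continuousR (C : R) (f : M -> R) :
  (forall x y, `|f x - f y| <= C * mdist x y) -> continuous f.
Proof.
move=> fC x; apply/cvgrPdist_lt => e e0.
have C0 : 0 < `|C| + 1 by rewrite ltr_wpDl.
apply/nbhs_ballP; exists (e / (`|C| + 1)); first exact: divr_gt0.
move=> y; rewrite !ballEmdist /= ltr_pdivlMr// => xy.
apply: le_lt_trans xy; apply: (le_trans (fC x y)); rewrite mulrC.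
by rewrite ler_wpM2l ?mdist_ge0// (le_trans (ler_norm C))// lerDl.
Qed.

Lemma mdist_lip (c x y : M) : `|mdist x c - mdist y c| <= mdist x y.
Proof.
have h1 := metric_triangle x y c; have h2 := metric_triangle y x c.
rewrite (metric_sym y x) in h2.
by rewrite ler_norml; apply/andP; split; lra.
Qed.

(** The witness is the distance to the complement truncated at [1]; the value
    [1] is put among the distances so that the infimum also makes sense for an
    empty complement. *)
Lemma metric_cozero_opens : cozero_opens R M.
Proof.
move=> O oO.
pose S x := [set r : R | r = 1 \/ exists2 y, ~ O y & r = mdist x y].
pose psi x := inf (S x).
have S1 x : S x 1 by left.
have S0 x : lbound (S x) 0 by move=> r [->|[y _ ->]]; rewrite ?mdist_ge0.
have hS x : has_inf (S x) by split; [exists 1|exists 0].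
have psi_le x r : S x r -> psi x <= r by move=> ?; apply: ge_inf => //; exists 0.
have psi0 x : 0 <= psi x by apply: lb_le_inf; [exists 1|].
have psi_lip x y : psi x <= psi y + mdist x y.
  rewrite -lerBlDr; apply: lb_le_inf; first by exists 1.
  move=> r [->|[z Oz ->]]; rewrite lerBlDr.
    by rewrite (le_trans (psi_le x 1 (S1 x)))// lerDl mdist_ge0.
  apply: (@le_trans _ _ (mdist x z)); first by apply: psi_le; right; exists z.
  by rewrite addrC; exact: metric_triangle.
exists psi; split => //.
  apply/CbP; split; last first.
    by exists 1 => x; rewrite ger0_norm// psi_le.
  apply: (@lipschitz_continuousR 1) => x y; rewrite mul1r ler_norml.
  have h1 := psi_lip x y; have h2 := psi_lip y x.
  by rewrite (metric_sym y x) in h2; apply/andP; split; lra.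
move=> x; split=> [Ox|]; last first.
  move=> p0; apply: contrapT => nO; move: p0; apply/negP; rewrite -leNgt.
  by rewrite -(mdistxx x); apply: psi_le; right; exists x.
have : nbhs x O by exact: open_nbhs_nbhs.
move=> /nbhs_ballP[d /= d0 dO].
apply: (@lt_le_trans _ _ (Num.min 1 d)); first by rewrite lt_min ltr01.
apply: lb_le_inf; first by exists 1.
move=> r [->|[y nOy ->]]; first by rewrite ge_min lexx.
rewrite ge_min; apply/orP; right; rewrite leNgt; apply/negP.
by move=> xy; apply: nOy; apply: dO; rewrite ballEmdist.
Qed.

End metric_functions.

Section seqspace_metric.
Context (R : realType) (E : completePMetricType R).
Local Notation X := (seqspace E).
Implicit Types x y : X.

Let term x y (n : nat) : R := 2 ^- n.+1 * Num.min (mdist (x n) (y n)) 1.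

Let term_ge0 x y n : 0 <= term x y n.
Proof. by rewrite mulr_ge0 ?invr_ge0 ?exprn_ge0// le_min mdist_ge0 ler01. Qed.

Let series_le1 x y n : series (term x y) n <= 1.
Proof.
suff : series (term x y) n <= 1 - 2 ^- n.
  by move=> /le_trans; apply; rewrite lerBlDr lerDl invr_ge0 exprn_ge0.
elim: n => [|n IH]; first by rewrite seriesEnat /= big_nil expr0 invr1 subrr.
rewrite seriesEnat /= big_nat_recr//= -[X in X + _]/(series (term x y) n).
have : term x y n <= 2 ^- n.+1.
  rewrite /term ler_piMr ?invr_ge0 ?exprn_ge0//.
  by rewrite ge_min lexx orbT.
have : 2 ^- n = 2 * 2 ^- n.+1 :> R by rewrite exprS invfM mulrA divff// mul1r.
move: IH; move: (series _ n) (2 ^- n) (2 ^- n.+1) (term x y n) => a b c d; lra.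
Qed.

Let cvg_term x y : cvgn (series (term x y)).
Proof.
apply: nondecreasing_is_cvgn.
  by apply: nondecreasing_series => i _ _; exact: term_ge0.
by exists 1 => _ [n _ <-].
Qed.

Lemma seqdist_le1 x y : mdist x y <= 1.
Proof. by apply: limr_le; [exact: cvg_term|apply: nearW => n; exact: series_le1]. Qed.

(** The recursion behind the other properties of the metric: prepending a
    coordinate halves it, the coordinates and the shift are continuous, and
    finitely many coordinates determine it up to a small error. *)
Lemma seqdist_shift x y : mdist x y =
  2^-1 * (Num.min (mdist (x 0%N) (y 0%N)) 1 + mdist (Defs.shift x) (Defs.shift y)).
Proof.
have /cvg_ex[l hl] := @cvg_term (Defs.shift x) (Defs.shift y).
have -> : mdist (Defs.shift x) (Defs.shift y) = l by apply/cvg_lim.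
apply/cvg_lim => //; rewrite -cvg_shiftS /=.
rewrite (_ : (fun n => _) = (fun n => 2^-1 * (Num.min (mdist (x 0%N) (y 0%N)) 1 +
    series (term (Defs.shift x) (Defs.shift y)) n))).
  by apply: cvgM; [exact: cvg_cst|apply: cvgD => //; exact: cvg_cst].
apply/funext => n; rewrite /= !seriesEnat /= big_nat_recl//= mulrDr.
rewrite expr1; congr (_ + _); rewrite mulr_sumr; apply: eq_bigr => i _.
by rewrite /term /Defs.shift mulrA -invfM -exprS.
Qed.

Lemma seqdist_scons a x y : mdist (scons a x : X) (scons a y) = 2^-1 * mdist x y.
Proof. by rewrite seqdist_shift /= mdistxx min_l ?ler01// add0r. Qed.

Lemma coord_lip n x y : Num.min (mdist (x n) (y n)) 1 <= 2 ^+ n.+1 * mdist x y.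
Proof.
elim: n x y => [|n IH] x y; rewrite seqdist_shift mulrA.
  by rewrite expr1 divff// mul1r lerDl mdist_ge0.
rewrite exprS (mulrC 2) mulfK//; apply: (le_trans (IH (Defs.shift x) (Defs.shift y))).
by rewrite ler_pM2l ?exprn_gt0// lerDr le_min mdist_ge0 ler01.
Qed.

Lemma seqdist_coord n d x y : 0 <= d -> (forall i, (i < n)%N -> mdist (x i) (y i) <= d) ->
  mdist x y <= d + 2 ^- n.
Proof.
move=> d0; elim: n x y => [|n IH] x y xy.
  by rewrite expr0 invr1 (le_trans (seqdist_le1 x y))// lerDr.
have h := IH (Defs.shift x) (Defs.shift y) (fun i => xy i.+1).
have h0 : Num.min (mdist (x 0%N) (y 0%N)) 1 <= d by rewrite ge_min xy.
rewrite seqdist_shift exprS invfM; lra.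
Qed.

Lemma continuous_shift : continuous (@Defs.shift E : X -> X).
Proof.
apply: (@lipschitz_continuous _ _ _ 2) => x y.
rewrite (seqdist_shift x y) mulrA divff// mul1r lerDr.
by rewrite le_min mdist_ge0 ler01.
Qed.

Lemma continuous_coord n : continuous (fun x : X => x n).
Proof.
apply: metric_continuous => x e e0.
have c0 : 0 < 2 ^+ n.+1 :> R by rewrite exprn_gt0.
exists (Num.min e 1 / 2 ^+ n.+1); first by rewrite divr_gt0// lt_min e0 ltr01.
move=> y; rewrite ltr_pdivlMr// mulrC.
move=> /(le_lt_trans (coord_lip n x y)).
rewrite gt_min => /orP[|]; rewrite lt_min; first by case/andP.
by rewrite ltxx andbF.
Qed.

Lemma continuous_scons x : continuous (fun a => scons a x : X).
Proof.
apply: (@lipschitz_continuous _ _ _ 1) => a b; rewrite seqdist_shift /= mul1r.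
rewrite [X in _ + X](_ : _ = 0) ?addr0; last exact: mdistxx.
have := mdist_ge0 a b; have : Num.min (mdist a b) 1 <= mdist a b by rewrite ge_min lexx.
lra.
Qed.

Lemma continuous_sconsr a : continuous (scons a : X -> X).
Proof. by apply: (@lipschitz_continuous _ _ _ 2^-1) => x y; rewrite seqdist_scons. Qed.

End seqspace_metric.

(** * Tight states on the sequence space *)

Section bump.
Context (R : realType) (E : metricType R).
Implicit Types (F : seq E) (a c : E) (eta : R).

(** A continuous substitute for the indicator of the complement of the
    [eta]-neighbourhood of the finite set [F]. *)
Fixpoint bump F eta a : R :=
  if F is c :: F' then Num.min (Num.min 1 (mdist a c / eta)) (bump F' eta a)
  else 1.

Lemma bump01 F eta a : 0 < eta -> 0 <= bump F eta a <= 1.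
Proof.
move=> eta0; elim: F => [|c F /andP[IH0 IH1]] /=; first by rewrite ler01 lexx.
by rewrite !le_min ler01 divr_ge0 ?mdist_ge0 ?(ltW eta0)//= IH0 !ge_min lexx.
Qed.

Lemma bump_ge0 F eta a : 0 < eta -> 0 <= bump F eta a.
Proof. by move=> /(bump01 F a)/andP[]. Qed.

Lemma bump_le1 F eta a : 0 < eta -> bump F eta a <= 1.
Proof. by move=> /(bump01 F a)/andP[]. Qed.

Lemma bump_norm F eta a : 0 < eta -> `|bump F eta a| <= 1.
Proof. by move=> e0; rewrite ger0_norm ?bump_ge0// bump_le1. Qed.

Let min_lip (u v u' v' d : R) : `|u - u'| <= d -> `|v - v'| <= d ->
  `|Num.min u v - Num.min u' v'| <= d.
Proof.
rewrite !ler_norml => /andP[? ?] /andP[? ?].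
by apply/andP; split; case: (leP u v) => ?; case: (leP u' v') => ?; lra.
Qed.

Lemma bump_lip F eta a b : 0 < eta ->
  `|bump F eta a - bump F eta b| <= mdist a b / eta.
Proof.
move=> eta0; have ab0 : 0 <= mdist a b / eta by rewrite divr_ge0 ?mdist_ge0 ?ltW.
elim: F => [|c F IH] /=; first by rewrite subrr normr0.
apply: min_lip => //; apply: min_lip; first by rewrite subrr normr0.
by rewrite -mulrBl normrM (gtr0_norm (_ : 0 < eta^-1)) ?invr_gt0//
  ler_pM2r ?invr_gt0// mdist_lip.
Qed.

Lemma Cb_bump F eta : 0 < eta -> Cb (bump F eta).
Proof.
move=> eta0; apply/CbP; split; last by exists 1 => a; exact: bump_norm.
by apply: (@lipschitz_continuousR _ _ eta^-1) => a b; rewrite mulrC; exact: bump_lip.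
Qed.

Lemma bump_mem F eta a c : c \in F -> bump F eta a <= mdist a c / eta.
Proof.
elim: F => // d F IH; rewrite in_cons => /orP[/eqP->|/IH h] /=.
  by rewrite !ge_min lexx orbT.
by rewrite ge_min h orbT.
Qed.

Lemma bump_lt1 F eta a : 0 < eta -> bump F eta a < 1 ->
  exists2 c, c \in F & mdist a c < eta.
Proof.
move=> eta0; elim: F => [|c F IH] /=; first by rewrite ltxx.
rewrite !gt_min ltxx /= => /orP[|/IH[d dF ad]]; last first.
  by exists d => //; rewrite in_cons dF orbT.
rewrite ltr_pdivrMr// mul1r => ac.
by exists c => //; rewrite in_cons eqxx.
Qed.

End bump.

Lemma ultra_seq (I : Type) (T : eqType) (U : set_system I) (F : seq T)
    (P : T -> set I) : UltraFilter U ->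
  U [set i | exists2 c, c \in F & P c i] -> exists2 c, c \in F & U (P c).
Proof.
move=> UU; elim: F => [|c F IH] h.
  have [i []] // := @filter_ex _ U _ _ h.
have [Uc|nUc] := in_ultra_setVsetC (P c) UU.
  by exists c; rewrite ?in_cons ?eqxx.
have [|d dF Ud] := IH.
  apply: filterS2 h nUc => i [d]; rewrite in_cons => /orP[/eqP->//|dF] Pd _.
  by exists d.
by exists d => //; rewrite in_cons dF orbT.
Qed.

Section tight.
Context (R : realType) (E : completePMetricType R).
Local Notation X := (seqspace E).
Variable L : (X -> R) -> R.
Hypothesis stL : state L.

(** Each coordinate is, up to small mass, close to a finite set.  In a complete
    space this is the functional form of tightness, since a closed set that is
    totally bounded in every coordinate is compact. *)
Definition tight := forall j (eta delta : R), 0 < eta -> 0 < delta ->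
  exists F : seq E, L (fun x => bump F eta (x j)) <= delta.

Lemma Cb_bump_coord F (eta : R) j : 0 < eta ->
  Cb (fun x : X => bump F eta (x j)).
Proof. by move=> /(Cb_bump F) /Cb_comp; apply; exact: continuous_coord. Qed.

Let sum_half n : \sum_(i < n) 2 ^- i.+1 <= 1 :> R.
Proof.
suff : \sum_(i < n) 2 ^- i.+1 = 1 - 2 ^- n :> R.
  by move=> ->; rewrite lerBlDr lerDl invr_ge0 exprn_ge0.
elim: n => [|n IH]; first by rewrite big_ord0 expr0 invr1 subrr.
have : 2 ^- n = 2 * 2 ^- n.+1 :> R by rewrite exprS invfM mulrA divff// mul1r.
by rewrite big_ord_recr /= IH => ->; lra.
Qed.

(** Off the set where the sum of the bump functions is at least [1], the first
    coordinates of a point are close to finite sets.  A sequence of points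
    [x_n] at which [f_n] stays large would therefore have a limit point in the
    complete space, where the whole sequence [f_n] would stay large. *)
Lemma tight_daniell : tight -> daniell L.
Proof.
move=> tL f_ cf f0 f_dec flim e e0.
have [M M0 fM] := Cb_bound (cf 0%N).
pose K := M + 1; have K0 : 0 < K by rewrite /K ltr_wpDl.
have f_homo n m x : (n <= m)%N -> f_ m x <= f_ n x.
  elim: m => [|m IH]; first by rewrite leqn0 => /eqP->.
  rewrite leq_eqVlt => /orP[/eqP->//|]; rewrite ltnS => /IH.
  by apply: le_trans; exact: f_dec.
have fK n x : f_ n x <= K.
  rewrite (le_trans (f_homo 0%N n x _))// (le_trans (ler_norm _))//.
  by rewrite (le_trans (fM x))// lerDl.
(* Weights of total mass at most [e / 2 / K], one for each coordinate [j] and each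
   precision [1 / (m + 1)]. *)
pose w (j m : nat) : R := e / 2 / K * (2 ^- j.+1 * 2 ^- m.+1).
have w0 j m : 0 < w j m.
  by rewrite !mulr_gt0 ?invr_gt0 ?exprn_gt0.
have eta0 (m : nat) : 0 < m.+1%:R^-1 :> R by rewrite invr_gt0.
have /choice[F FP] (p : nat * nat) :
    exists F, L (fun x => bump F p.2.+1%:R^-1 (x p.1)) <= w p.1 p.2.
  exact: tL.
pose b j m (x : X) := bump (F (j, m)) m.+1%:R^-1 (x j).
have cb j m : Cb (b j m) by exact: Cb_bump_coord.
have b0 j m x : 0 <= b j m x by exact: bump_ge0.
pose S n x := \sum_(j < n) \sum_(m < n) b j m x.
have cS n : Cb (S n) by apply: Cb_sum => j; exact: Cb_sum.
have LS n : L (S n) <= e / 2 / K.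
  rewrite (state_sum stL); last by move=> j; exact: Cb_sum.
  apply: (@le_trans _ _ (\sum_(j < n) \sum_(m < n) w j m)).
    apply: ler_sum => j _; rewrite (state_sum stL)//.
    by apply: ler_sum => m _; exact: (FP (val j, val m)).
  rewrite /w; under eq_bigr do rewrite -mulr_sumr -mulr_sumr.
  rewrite -mulr_sumr -mulr_suml ler_piMr//.
    by rewrite !mulr_ge0 ?invr_ge0 ?(ltW e0) ?(ltW K0).
  by rewrite mulr_ile1// sumr_ge0// => i _; rewrite invr_ge0 exprn_ge0.
suff [n fn] : exists n, forall x, f_ n x <= e / 2 + K * S n x.
  exists n.
  have cKS : Cb (fun x => K * S n x) by exact: CbZ.
  have ce : Cb (fun _ : X => e / 2) by exact: Cb_cst.
  have := state_le stL (cf n) (CbD ce cKS) fn.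
  rewrite (stateD stL)// (state_cst stL) (stateZ stL)// => /le_trans; apply.
  have := LS n; rewrite ler_pdivlMr// mulrC; lra.
apply: contrapT => nex.
have {nex}/choice[x xP] n : exists x, e / 2 + K * S n x < f_ n x.
  apply: contrapT => h; apply: nex; exists n => x; rewrite leNgt.
  by apply/negP => ?; apply: h; exists x.
(* [S n (x n) < 1] forces every bump function in the sum to be below [1]. *)
have near_F j m n : (j < n)%N -> (m < n)%N ->
    exists2 c, c \in F (j, m) & mdist (x n j) c < m.+1%:R^-1.
  move=> jn mn; apply: bump_lt1 => //.
  have Sb : b j m (x n) <= S n (x n).
    rewrite /S (bigD1 (Ordinal jn))//= (bigD1 (Ordinal mn))//= -addrA lerDl.
    by rewrite addr_ge0 ?sumr_ge0// => ? _; rewrite sumr_ge0.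
  rewrite -/(b j m (x n)) (le_lt_trans Sb)// -(ltr_pM2l K0) mulr1.
  by have := xP n; have := fK n (x n); lra.
have [U [UU Uoo]] := @ultraFilterLemma nat \oo _.
have cauchyj j : cauchy ((fun n => x n j) @ U).
  apply/cauchy_exP => d d0 /=.
  pose m := Num.truncn d^-1.
  have md : m.+1%:R^-1 <= d by rewrite invf_ple ?posrE// ltW// truncnS_gt.
  have [c _ Uc] : exists2 c, c \in F (j, m) & U [set n | mdist (x n j) c < m.+1%:R^-1].
    apply: ultra_seq; apply: Uoo; exists (maxn j m).+1 => // n /=.
    by rewrite gtn_max => /andP[jn mn]; exact: near_F.
  exists c; rewrite /fmap /=; apply: filterS Uc => n /= xc.
  by rewrite ballEmdist /= metric_sym (lt_le_trans xc).
have /choice[y yP] j : exists yj : E, (fun n => x n j) @ U --> yj.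
  have h : cvg ((fun n => x n j) @ U) by exact: cauchy_cvg (cauchyj j).
  by exists (lim ((fun n => x n j) @ U)).
have xy : x @ U --> (y : X).
  apply/cvg_ballP => d d0.
  have [n nd] : exists n, 2 ^- n < d / 2 :> R.
    exists (Num.truncn (d / 2)^-1).+1; rewrite invf_plt ?posrE ?exprn_gt0 ?divr_gt0//.
    apply: (lt_trans (truncnS_gt _)).
    by rewrite -natrX ltr_nat; exact: ltn_expl.
  have : \forall k \near U, forall i, (i < n)%N -> mdist (y i) (x k i) <= d / 2.
    elim: n {nd} => [|n IH]; first exact: nearW.
    have /cvg_ballP /(_ (d / 2)) h := yP n.
    have {}h : \forall k \near U, ball (y n) (d / 2) (x k n).
      by apply: h; rewrite divr_gt0.
    near=> k => i; rewrite ltnS leq_eqVlt => /orP[/eqP->|].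
      apply: ltW; have : ball (y n) (d / 2) (x k n) by near: k.
      by rewrite ballEmdist.
    by move: i; near: k.
  apply: filterS => k hk; rewrite ballEmdist /=.
  apply: (@le_lt_trans _ _ (d / 2 + 2 ^- n)); last by rewrite [ltRHS]splitr ltrD2l.
  by apply: seqdist_coord => //; rewrite divr_ge0// ltW.
have fy k : e / 2 <= f_ k y.
  have fxy : (fun n => f_ k (x n)) @ U --> f_ k y.
    by apply: (cvg_comp x (f_ k) xy); exact: Cb_continuous.
  apply: (cvgr_to_ge fxy); apply: Uoo; exists k => // n /= kn.
  apply: (le_trans _ (f_homo k n (x n) kn)); apply: ltW.
  apply: le_lt_trans (xP n); rewrite lerDl mulr_ge0 ?(ltW K0)//.
  by apply: sumr_ge0 => i _; exact: sumr_ge0.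
have [|n fn] := flim y (e / 4); first by rewrite divr_gt0.
by have := le_trans (fy n) fn; lra.
Unshelve. all: by end_near.
Qed.

End tight.

(** * Integration against finitely additive measures *)

Section finitely_additive.
Context (R : realType) (T : ptopologicalType) (mu : rba R T).
Implicit Types s t : {sfun (borel T) >-> R}.

Let mu_rba : is_rba mu.
Proof. by have /asboolP := rba_funP mu. Qed.

Lemma rba0 : mu set0 = 0.
Proof.
have := rba_additive mu_rba (@measurable0 _ (borel T)) (@measurable0 _ (borel T)).
by rewrite setI0 setU0 => /(_ erefl)/eqP; rewrite addrC -subr_eq subrr => /eqP <-.
Qed.

Lemma rba_preimage (V : choiceType) (w : T -> V) (r : seq V) :
  (forall c, measurable (w @^-1` [set c] : set (borel T))) -> uniq r ->
  mu [set x | w x \in r] = \sum_(c <- r) mu (w @^-1` [set c]).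
Proof.
move=> mw; elim: r => [_|c r IH /= /andP[cr ur]].
  rewrite big_nil (_ : [set x | _] = set0) ?rba0//.
  by apply/seteqP; split.
rewrite big_cons -IH// -(rba_additive mu_rba).
- congr (rba_fun mu); apply/seteqP; split => x /=; rewrite in_cons.
    by case/orP => [/eqP|]; [left|right].
  by case=> [->|->]; rewrite ?eqxx ?orbT.
- exact: mw.
- rewrite (_ : [set x | _] = \big[setU/set0]_(d <- r) (w @^-1` [set d])).
    by apply: bigsetU_measurable => d _; exact: mw.
  rewrite -bigcup_seq; apply/seteqP; split => [x /= wr|x [d /= dr ->]//].
  by exists (w x).
- by apply/seteqP; split => // x [/= wc]; rewrite wc (negbTE cr).
Qed.

Lemma rba_bound : exists2 V, 0 <= V &
  forall A : set (borel T), measurable A -> `|mu A| <= V.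
Proof.
have [V hV] := rba_bounded mu_rba; exists V => //.
by rewrite (le_trans _ (hV _ measurable0)).
Qed.

Let sum_pick (V : eqType) (r : seq V) a (F : R) : uniq r ->
  \sum_(y <- r | a == y) F = if a \in r then F else 0.
Proof.
elim: r => [_|y r IH /= /andP[yr ur]]; first by rewrite big_nil.
rewrite big_cons IH// in_cons; case: eqVneq => [->|//] /=.
by rewrite (negbTE yr) addr0.
Qed.

(** Additivity groups the cells [w = c] with the same value of [h]; a cell whose
    value is not taken by [s] is empty. *)
Lemma simple_integral_partition (V : choiceType) (w : T -> V) (h : V -> R)
    (r : seq V) s :
  (forall c, measurable (w @^-1` [set c] : set (borel T))) -> uniq r ->
  (forall x, w x \in r) -> (forall x, s x = h (w x)) ->
  simple_integral mu s = \sum_(c <- r) h c * mu (w @^-1` [set c]).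
Proof.
move=> mw ur wr sh.
have frs : finite_set (range s) by exact: fimfunP.
rewrite /simple_integral fsbig_finite//.
have urs : uniq (finmap.enum_fset (fset_set (range s))).
  exact: finmap.fset_uniq.
rewrite (eq_bigr (fun y => \sum_(c <- r | h c == y) h c * mu (w @^-1` [set c]))).
  under eq_bigr do rewrite big_mkcond/=.
  rewrite exchange_big/=; apply: eq_big_seq => c cr.
  rewrite -big_mkcond/= sum_pick//; case: ifPn => // hc.
  rewrite (_ : w @^-1` [set c] = set0) ?rba0 ?mulr0//.
  apply/seteqP; split => // x /= wx; move: hc; rewrite in_fset_set//.
  by case/negP; rewrite inE; exists x => //; rewrite sh wx.
move=> y _; transitivity (\sum_(c <- r | h c == y) y * mu (w @^-1` [set c])).
  rewrite -mulr_sumr; congr (_ * _).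
  rewrite -big_filter -rba_preimage ?filter_uniq//; congr (rba_fun mu).
  apply/seteqP; split => x /=; rewrite mem_filter sh; first by move=> ->; rewrite eqxx wr.
  by case/andP => /eqP.
by apply: eq_bigr => c /eqP ->.
Qed.

Let enum s := finmap.enum_fset (fset_set (range s)).

Let enum_uniq s : uniq (enum s).
Proof. exact: finmap.fset_uniq. Qed.

Let mem_enum s x : s x \in enum s.
Proof.
by rewrite /enum in_fset_set; [rewrite inE; exists x|exact: fimfunP].
Qed.

(** The common refinement of the level sets of two simple functions. *)
Let pair_enum s t : [/\ uniq (undup [seq (a, b) | a <- enum s, b <- enum t]),
  forall c, measurable ((fun x => (s x, t x)) @^-1` [set c] : set (borel T)) &
  forall x, (s x, t x) \in undup [seq (a, b) | a <- enum s, b <- enum t]].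
Proof.
split; first exact: undup_uniq.
- move=> [a b]; rewrite (_ : _ @^-1` _ = s @^-1` [set a] `&` t @^-1` [set b]).
    by apply: measurableI; exact: measurable_funPTI.
  by apply/seteqP; split => x /= [] => [-> ->|-> ->].
- by move=> x; rewrite mem_undup; apply: allpairs_f; exact: mem_enum.
Qed.

Lemma simple_integralD s t :
  simple_integral mu (s + t) = simple_integral mu s + simple_integral mu t.
Proof.
have [ur mw wr] := pair_enum s t.
rewrite (simple_integral_partition (h := fun c => c.1 + c.2) mw ur wr)//.
rewrite (simple_integral_partition (h := fst) mw ur wr)//.
rewrite (simple_integral_partition (h := snd) mw ur wr)//.
by rewrite -big_split/=; apply: eq_bigr => c _; rewrite mulrDl.
Qed.

Lemma simple_integralZ k s :
  simple_integral mu (cst_sfun k * s) = k * simple_integral mu s.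
Proof.
have ms c : measurable (s @^-1` [set c] : set (borel T)) by exact: measurable_funPTI.
rewrite (simple_integral_partition (h := fun c => k * c) ms (enum_uniq s) (mem_enum s))//.
rewrite (simple_integral_partition (h := id) ms (enum_uniq s) (mem_enum s))//.
by rewrite mulr_sumr; apply: eq_bigr => c _; rewrite mulrA.
Qed.

(** Grouping the cells of positive and of negative measure bounds the total
    variation over a partition by twice a bound of [mu]. *)
Lemma simple_integral_dist V s t d : 0 <= d ->
  (forall A : set (borel T), measurable A -> `|mu A| <= V) ->
  (forall x, `|s x - t x| <= d) ->
  `|simple_integral mu s - simple_integral mu t| <= d * (2 * V).
Proof.
move=> d0 muV st; have [] := pair_enum s t.
set w := fun x : T => (s x, t x); set r := undup _ => ur mw wr.
rewrite (simple_integral_partition (h := fst) mw ur wr)//.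
rewrite (simple_integral_partition (h := snd) mw ur wr)//.
rewrite -sumrB; under eq_bigr do rewrite -mulrBl.
apply: (@le_trans _ _ (\sum_(c <- r) d * `|mu (w @^-1` [set c])|)).
  apply: (le_trans (ler_norm_sum _ _ _)); apply: ler_sum => c _.
  rewrite normrM; have [->|/set0P[x wx]] := eqVneq (w @^-1` [set c]) set0.
    by rewrite rba0 normr0 !mulr0.
  by rewrite ler_wpM2r// -wx; exact: st.
rewrite -mulr_sumr ler_wpM2l//.
pose P := [pred c | 0 <= mu (w @^-1` [set c])].
have mr (q : seq (R * R)) : uniq q -> `|\sum_(c <- q) mu (w @^-1` [set c])| <= V.
  move=> uq; rewrite -rba_preimage//; apply: muV.
  rewrite (_ : [set x | _] = \big[setU/set0]_(d <- q) (w @^-1` [set d])).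
    by apply: bigsetU_measurable => e _; exact: mw.
  rewrite -bigcup_seq; apply/seteqP; split => [x /= wx|x [e /= er ->]//].
  by exists (w x).
rewrite (bigID P)/= mulr_natl mulr2n; apply: lerD.
  rewrite (eq_bigr (fun c => mu (w @^-1` [set c]))); last first.
    by move=> c Pc; rewrite ger0_norm.
  by rewrite -big_filter (le_trans (ler_norm _))// mr// filter_uniq.
rewrite (eq_bigr (fun c => - mu (w @^-1` [set c]))); last first.
  by move=> c; rewrite -ltNge => Pc; rewrite ltr0_norm.
rewrite sumrN -big_filter (le_trans (ler_norm _))// normrN.
by apply: mr; rewrite filter_uniq.
Qed.

Lemma simple_integral_rbaE s : simple_integral mu s =
  \sum_(c <- enum s) c * mu (s @^-1` [set c]).
Proof.
exact: (simple_integral_partition (h := id)).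
Qed.

(** A single good simple approximation for each precision is enough, because
    nearby simple functions have nearby integrals. *)
Lemma has_integral_approx f I :
  (forall e, 0 < e -> exists2 s : {sfun (borel T) >-> R},
    forall x, `|f x - s x| <= e & `|simple_integral mu s - I| <= e) ->
  has_integral mu f I.
Proof.
move=> h e e0; have [V V0 muV] := rba_bound.
have V1 : 0 < 4 * V + 1 by rewrite ltr_wpDl// mulr_ge0.
pose d := e / 2 / (4 * V + 1).
have d0 : 0 < d by rewrite !divr_gt0.
have de : d * (4 * V) + d = e / 2.
  by rewrite -[X in _ + X]mulr1 -mulrDr /d divfK// gt_eqF.
exists d => // s fs.
have [|t ft tI] := h (Num.min d (e / 2)); first by rewrite lt_min d0 divr_gt0.
have st x : `|s x - t x| <= d + d.
  rewrite (_ : s x - t x = (f x - t x) - (f x - s x)); last by lra.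
  rewrite (le_trans (ler_normB _ _))// lerD//.
  by rewrite (le_trans (ft x))// ge_min lexx.
have := simple_integral_dist (addr_ge0 (ltW d0) (ltW d0)) muV st.
have {}tI : `|simple_integral mu t - I| <= e / 2.
  by rewrite (le_trans tI)// ge_min lexx orbT.
rewrite (_ : simple_integral mu s - I = (simple_integral mu s -
  simple_integral mu t) + (simple_integral mu t - I)); last by lra.
move=> h1; apply: (le_trans (ler_normD _ _)).
have := ltW d0; lra.
Qed.

End finitely_additive.

Section simple_approximation.
Context (R : realType) (T : ptopologicalType).

(** Rounding [f] down to a multiple of [e]; boundedness leaves finitely many. *)
Lemma Cb_simple_approx (f : T -> R) (e : R) : Cb f -> 0 < e ->
  exists s : {sfun (borel T) >-> R}, forall x, `|f x - s x| <= e.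
Proof.
move=> cf e0; have [M M0 fM] := Cb_bound cf.
pose k x := Num.truncn ((f x + M) / e).
have fM0 x : 0 <= (f x + M) / e.
  rewrite divr_ge0 ?(ltW e0)//.
  by have := fM x; rewrite ler_norml => /andP[+ _]; lra.
have kP x : (k x)%:R * e <= f x + M < ((k x).+1)%:R * e.
  by rewrite -ler_pdivlMr// -ltr_pdivrMr//; exact: truncn_itv.
pose g x := (k x)%:R * e - M.
have mf : measurable_fun setT (f : borel T -> R).
  by apply: continuous_borel; exact: Cb_continuous.
have mk n : measurable (k @^-1` [set n] : set (borel T)).
  rewrite (_ : _ @^-1` _ = f @^-1` `[n%:R * e - M, n.+1%:R * e - M[%classic).
    by rewrite -[X in measurable X]setTI; exact: mf.
  apply/seteqP; split => x /=.
    by move=> kx; have := kP x; rewrite kx in_itv/= lerBlDr ltrBrDr.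
  rewrite in_itv/= lerBlDr ltrBrDr => /andP[h1 h2]; apply: truncn_def.
  by rewrite ler_pdivlMr// ltr_pdivrMr// h1.
have mg : measurable_fun setT (g : borel T -> R).
  move=> _ Y mY; rewrite setTI.
  rewrite (_ : _ @^-1` _ = \bigcup_(n in [set n : nat | Y (n%:R * e - M)])
    (k @^-1` [set n])); last first.
    by apply/seteqP; split => [x /= Yx|x [n /= Yn kx]]; [exists (k x)|rewrite /g kx].
  by apply: bigcup_measurable => n _.
have fg : finite_set (range g).
  apply: (@sub_finite_set _ _ ((fun n : nat => n%:R * e - M) @`
    `I_((Num.truncn ((M + M) / e)).+1))); last exact: finite_image.
  move=> _ [x _ <-]; exists (k x) => //=; rewrite ltnS; apply: le_truncn.
  rewrite ler_pM2r ?invr_gt0// lerD2r.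
  by rewrite (le_trans (ler_norm _))//.
have gs : g \in (@sfun _ (borel T) R) by apply/andP; split; rewrite inE.
exists (sfun_Sub gs) => x /=; have /andP[] := kP x.
by rewrite /g -[(k x).+1]addn1 natrD mulrDl mul1r ler_norml => h1 h2; apply/andP; split; lra.
Qed.

Variable mu : rba R T.

Lemma has_integral_unique f I J : Cb f ->
  has_integral mu f I -> has_integral mu f J -> I = J.
Proof.
move=> cf hI hJ; apply/eqP; rewrite -subr_eq0 -normr_le0.
apply/ler_addgt0Pr => e e0; rewrite add0r.
have e2 : 0 < e / 2 by rewrite divr_gt0.
have [d d0 dI] := hI _ e2; have [d' d'0 dJ] := hJ _ e2.
have [|s fs] := @Cb_simple_approx f (Num.min d d') cf; first by rewrite lt_min d0.
have := dI s (fun x => le_trans (fs x) _); rewrite ge_min lexx => /(_ isT) h1.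
have := dJ s (fun x => le_trans (fs x) _); rewrite ge_min lexx orbT => /(_ isT) h2.
rewrite (_ : I - J = (simple_integral mu s - J) - (simple_integral mu s - I)).
  by rewrite (le_trans (ler_normB _ _))//; lra.
by lra.
Qed.

Lemma pairing_eq f I : Cb f -> has_integral mu f I -> pairing mu f = I.
Proof.
move=> cf hI; apply: (has_integral_unique cf) => //.
by rewrite /pairing; apply: getPex; exists I.
Qed.

Lemma has_integral_exists f : Cb f -> exists I, has_integral mu f I.
Proof.
move=> cf; have [V V0 muV] := rba_bound mu.
have n0 n : 0 < n.+1%:R^-1 :> R by rewrite invr_gt0.
have /choice[s sP] n := Cb_simple_approx cf (n0 n).
pose u n := simple_integral mu (s n).
have uP n m : `|u n - u m| <= (n.+1%:R^-1 + m.+1%:R^-1) * (2 * V).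
  apply: (simple_integral_dist (addr_ge0 (ltW (n0 n)) (ltW (n0 m))) muV) => x.
  rewrite (_ : s n x - s m x = (f x - s m x) - (f x - s n x)); last by lra.
  by rewrite (le_trans (ler_normB _ _))// addrC lerD.
have ucvg : cvgn u.
  apply/cauchy_cvgP/cauchy_exP => e e0.
  pose N := Num.truncn ((2 * (2 * V) + 1) / e).
  have V1 : 0 < 2 * (2 * V) + 1 by rewrite ltr_wpDl// !mulr_ge0.
  have Ne : N.+1%:R^-1 * (2 * (2 * V) + 1) < e.
    by rewrite ltr_pdivrMl// -ltr_pdivrMr// truncnS_gt.
  exists (u N); exists N => // n /= Nn.
  rewrite /ball/=; apply: le_lt_trans Ne; apply: (le_trans (uP N n)).
  have nN : n.+1%:R^-1 <= N.+1%:R^-1 :> R by rewrite lef_pV2 ?posrE// ler_nat ltnS.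
  move: (ler_wpM2r V0 nN) (n0 N).
  by move: (N.+1%:R^-1 : R) (n.+1%:R^-1 : R) => a b; lra.
have /cvg_ex[I uI] := ucvg.
exists I; apply: has_integral_approx => e e0.
move/cvgrPdist_le: uI => /(_ e e0)[N _ Nu].
pose n := maxn N (Num.truncn e^-1).
exists (s n); last by rewrite distrC; apply: Nu; rewrite /= leq_maxl.
move=> x; apply: (le_trans (sP n x)).
rewrite invf_ple ?posrE// ltW// (lt_le_trans (truncnS_gt _))//.
by rewrite ler_nat ltnS leq_maxr.
Qed.

Lemma pairingP f : Cb f -> has_integral mu f (pairing mu f).
Proof.
by move=> cf; rewrite /pairing; apply: getPex; exact: has_integral_exists.
Qed.

Lemma pairing_approx f e : Cb f -> 0 < e ->
  exists2 s : {sfun (borel T) >-> R},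
    forall x, `|f x - s x| <= e & `|simple_integral mu s - pairing mu f| <= e.
Proof.
move=> cf e0; have [d d0 dP] := pairingP cf e0.
have [|s fs] := @Cb_simple_approx f (Num.min d e) cf; first by rewrite lt_min d0.
exists s; first by move=> x; rewrite (le_trans (fs x))// ge_min lexx orbT.
by apply: dP => x; rewrite (le_trans (fs x))// ge_min lexx.
Qed.

Lemma pairingD f g : Cb f -> Cb g ->
  pairing mu (fun x => f x + g x) = pairing mu f + pairing mu g.
Proof.
move=> cf cg; apply: pairing_eq; first exact: CbD.
apply: has_integral_approx => e e0; have e2 : 0 < e / 2 by rewrite divr_gt0.
have [s fs sI] := pairing_approx cf e2; have [t gt tI] := pairing_approx cg e2.
exists (s + t) => [x|].
  rewrite sfunD /= (_ : f x + g x - _ = (f x - s x) + (g x - t x)); last by lra.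
  by rewrite (le_trans (ler_normD _ _))// [leRHS]splitr lerD.
rewrite simple_integralD.
rewrite (_ : _ - _ = (simple_integral mu s - pairing mu f) +
  (simple_integral mu t - pairing mu g)); last by lra.
by rewrite (le_trans (ler_normD _ _))// [leRHS]splitr lerD.
Qed.

Lemma pairingZ k f : Cb f -> pairing mu (fun x => k * f x) = k * pairing mu f.
Proof.
move=> cf; apply: pairing_eq; first exact: CbZ.
apply: has_integral_approx => e e0.
have k0 : 0 < `|k| + 1 by rewrite ltr_wpDl.
have [s fs sI] := pairing_approx cf (divr_gt0 e0 k0).
have ke : `|k| * (e / (`|k| + 1)) <= e.
  by rewrite mulrCA ger_pMr// ler_pdivrMr// mul1r lerDl.
exists (cst_sfun k * s) => [x|].
  by rewrite sfunM /= -mulrBr normrM (le_trans _ ke)// ler_wpM2l.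
by rewrite simple_integralZ -mulrBr normrM (le_trans _ ke)// ler_wpM2l.
Qed.

Lemma pairing_state : M1a mu <-> state (pairing mu).
Proof.
split=> [[mu1 mu0]|st]; last by split; [exact: state1|move=> f; exact: state_ge0].
by split=> //; [exact: pairingD|exact: pairingZ].
Qed.

End simple_approximation.

Lemma pairing_linear (R : realType) (T : ptopologicalType) (mu nu : rba R T)
  (k l : R) f : Cb f ->
  pairing (k *: mu + l *: nu) f = k * pairing mu f + l * pairing nu f.
Proof.
move=> cf; apply: pairing_eq => //; apply: has_integral_approx => e e0.
have k0 : 0 < `|k| + `|l| + 1 by rewrite ltr_wpDl// addr_ge0.
pose d := e / (`|k| + `|l| + 1); have d0 : 0 < d by rewrite divr_gt0.
have de : `|k| * d + `|l| * d <= e.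
  by rewrite -mulrDl mulrCA ger_pMr// ler_pdivrMr// mul1r lerDl.
have [d1 d10 h1] := pairingP mu cf d0; have [d2 d20 h2] := pairingP nu cf d0.
have [|s fs] := @Cb_simple_approx _ _ f (Num.min e (Num.min d1 d2)) cf.
  by rewrite !lt_min e0 d10.
exists s; first by move=> x; rewrite (le_trans (fs x))// ge_min lexx.
have {}h1 : `|simple_integral mu s - pairing mu f| <= d.
  by apply: h1 => x; rewrite (le_trans (fs x))// !ge_min lexx orbT.
have {}h2 : `|simple_integral nu s - pairing nu f| <= d.
  by apply: h2 => x; rewrite (le_trans (fs x))// !ge_min lexx !orbT.
have -> : simple_integral (k *: mu + l *: nu) s =
    k * simple_integral mu s + l * simple_integral nu s.
  rewrite !simple_integral_rbaE !mulr_sumr -big_split/=; apply: eq_bigr => c _.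
  by rewrite [X in c * X](_ : _ = k * mu (s @^-1` [set c]) +
    l * nu (s @^-1` [set c]))// mulrDr !(mulrCA c).
rewrite (_ : _ - _ = k * (simple_integral mu s - pairing mu f) +
  l * (simple_integral nu s - pairing nu f)); last by lra.
rewrite (le_trans (ler_normD _ _))// !normrM (le_trans _ de)//.
by rewrite lerD// ler_wpM2l.
Qed.

Lemma rba_cvg (R : realType) (T : ptopologicalType) (U : set_system (rba R T)) (mu : rba R T) :
  Filter U ->
  (forall h : T -> R, Cb h -> pairing nu h @[nu --> U] --> pairing mu h) ->
  U --> mu.
Proof.
move=> FU h.
have hU : @eval_Cb R T @ U --> @eval_Cb R T mu.
  apply/cvg_sup => i A [_ [[V oV <-] Vmu VA]].
  have ci : Cb (val i) by case: (i) => /= ? /set_mem.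
  have := h _ ci V (open_nbhs_nbhs (conj oV Vmu)).
  by rewrite /fmap /nbhs /=; apply: filterS => nu; exact: VA.
move=> A [_ [[V oV <-] Vmu VA]].
have := hU V (open_nbhs_nbhs (conj oV Vmu)).
by rewrite /fmap /nbhs /=; apply: filterS => nu; exact: VA.
Qed.

(** * Countably additive measures as elements of the dual *)

Section rba_of_probability.
Context (R : realType) (T : ptopologicalType) (nu : probability (borel T) R).
Hypothesis outer_regular : forall (A : set (borel T)) (e : R), 0 < e ->
  exists O : set (borel T),
    [/\ open (O : set T), A `<=` O & (nu O <= nu A + e%:E)%E].

(** The value [0] off the Borel sets is the normalisation of the elements of
    [rba]. *)
Definition prob_fun (A : set T) : R^o :=
  if pselect (measurable (A : set (borel T))) then fine (nu A) else 0.

Let prob_funE (A : set (borel T)) : measurable A -> prob_fun A = fine (nu A).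
Proof. by move=> mA; rewrite /prob_fun; case: pselect. Qed.

Let fin_nu (A : set (borel T)) : measurable A -> nu A \is a fin_num.
Proof. by move=> mA; exact: fin_num_measure. Qed.

Let le_nu (A B : set (borel T)) : measurable A -> measurable B -> A `<=` B ->
  fine (nu A) <= fine (nu B).
Proof.
move=> mA mB AB; apply: fine_le; rewrite ?fin_nu//.
by apply: le_measure => //; rewrite inE.
Qed.

Let nuD (A B : set (borel T)) : measurable A -> measurable B ->
  A `&` B = set0 -> fine (nu (A `|` B)) = fine (nu A) + fine (nu B).
Proof.
by move=> mA mB AB; rewrite measureU// fineD// fin_nu.
Qed.

Let outer (A : set (borel T)) (e : R) : measurable A -> 0 < e ->
  exists O : set T, [/\ open O, A `<=` O & fine (nu (O `\` A)) <= e].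
Proof.
move=> mA e0; have [ O [oO AO OA]] := outer_regular A e0; exists O; split=> //.
have mO : measurable (O : set (borel T)) by exact: borel_open.
have mOA : measurable (O `\` A : set (borel T)) by exact: measurableD.
have : fine (nu (A `|` (O `\` A))) <= fine (nu A) + e.
  rewrite -lee_fin EFinD !fineK ?fin_nu//; last exact: measurableU.
  by rewrite setDE setUIr setUv setIT (setUidr AO).
rewrite nuD ?lerD2l//.
by apply/seteqP; split=> // x [Ax []].
Qed.

(** Outer regularity of a set and of its complement gives the open set above and
    the closed set below that regularity asks for. *)
Lemma prob_fun_rba : is_rba prob_fun.
Proof.
split.
- by move=> A mA; rewrite /prob_fun; case: pselect.
- by move=> A B mA mB AB; rewrite !prob_funE ?nuD//; exact: measurableU.
- exists 1 => A mA; rewrite prob_funE// ger0_norm ?fine_ge0//.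
  by rewrite -lee_fin fineK ?fin_nu// probability_le1.
move=> A e mA e0.
have e4 : 0 < e / 4 by rewrite divr_gt0.
have [U [oU AU hU]] := outer mA e4.
have [V [oV AV hV]] := outer (measurableC mA) e4.
exists (~` V), U; split => //.
- exact: open_closedC.
- by move=> x nVx; apply: contrapT => nA; apply: nVx; apply: AV.
move=> C mC CUV; rewrite prob_funE// ger0_norm ?fine_ge0//.
have mU : measurable (U `\` A : set (borel T)) by apply: measurableD => //; exact: borel_open.
have mV : measurable (V `\` ~` A : set (borel T)).
  by apply: measurableD; [exact: borel_open|exact: measurableC].
have mUV := measurableU _ _ mU mV.
have : fine (nu C) <= fine (nu ((U `\` A) `|` (V `\` ~` A))).
  apply: le_nu => // x /CUV[Ux nVx].
  have Vx : V x by exact: contrapT.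
  by have [Ax|nAx] := pselect (A x); [right; split=> // /(_ Ax)|left].
rewrite nuD//; last by apply/seteqP; split=> // x [[_ nA] [_ nnA]]; exact: nnA.
lra.
Qed.

Definition rba_of_prob : rba R T :=
  Rba (introT (asboolP _) prob_fun_rba : prob_fun \in @rba_pred R T).

Lemma rba_of_prob_pairing (f : T -> R) : Cb f ->
  pairing rba_of_prob f = \int[nu]_x f x.
Proof.
move=> cf; apply: pairing_eq => //; apply: has_integral_approx => e e0.
have [s fs] := Cb_simple_approx cf e0; exists s => //.
have ms c : measurable (s @^-1` [set c] : set (borel T)) by exact: measurable_funPTI.
have is_ : nu.-integrable setT (EFin \o s).
  have [M [_ hM]] := simple_bounded s.
  apply: (@bounded_integrable _ _ _ _ (M + 1)).
    exact: measurable_funPT.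
  by move=> x; apply: hM => //; rewrite ltrDl.
have ii c : nu.-integrable setT (EFin \o (fun x => c * \1_(s @^-1` [set c]) x)).
  apply: (@bounded_integrable _ _ _ _ `|c|).
    by apply: measurable_funM => //; exact: measurable_indic.
  move=> x; rewrite normrM indicE ler_piMr//.
  by case: (_ \in _); rewrite ?normr1 ?normr0.
have -> : simple_integral rba_of_prob s = \int[nu]_x s x.
  rewrite simple_integral_rbaE; set r := finmap.enum_fset _.
  have sE : (s : T -> R) = fun x => \sum_(c <- r) c * \1_(s @^-1` [set c]) x.
    apply/funext => x; rewrite (fimfunE s) fsbig_finite//; exact: fimfunP.
  rewrite [in RHS]sE.
  (* The sum over the range of [s] is integrated term by term. *)
  suff H (q : seq R) : nu.-integrable setT (EFin \o
      (fun x => \sum_(c <- q) c * \1_(s @^-1` [set c]) x)) /\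
      \int[nu]_x (\sum_(c <- q) c * \1_(s @^-1` [set c]) x) =
      \sum_(c <- q) c * prob_fun (s @^-1` [set c]).
    by case: (H r).
  elim: q => [|c q [IH1 IH2]].
    rewrite big_nil (_ : (fun _ => _) = fun=> 0); last first.
      by apply/funext => x; rewrite big_nil.
    split; first exact: Cb_integrable (Cb_cst T 0).
    exact: (state_cst (state_integral nu) 0).
  rewrite big_cons (_ : (fun _ => _) = fun x => c * \1_(s @^-1` [set c]) x +
    \sum_(d <- q) d * \1_(s @^-1` [set d]) x); last first.
    by apply/funext => x; rewrite big_cons.
  have -> : \int[nu]_x (c * \1_(s @^-1` [set c]) x +
      \sum_(d <- q) d * \1_(s @^-1` [set d]) x) =
      c * prob_fun (s @^-1` [set c]) + \sum_(d <- q) d * prob_fun (s @^-1` [set d]).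
    rewrite RintegralD// IH2; congr (_ + _).
    rewrite RintegralZl//; last first.
      apply: (@bounded_integrable _ _ _ _ 1); first exact: measurable_indic.
      by move=> x; rewrite indicE; case: (_ \in _); rewrite ?normr1 ?normr0.
    by congr (_ * _); rewrite /Rintegral integral_indic// setIT prob_funE.
  by split => //; exact: (integrableD measurableT (ii c) IH1).
rewrite -RintegralB//; last exact: Cb_integrable.
have ifs : nu.-integrable setT (EFin \o (fun x => s x - f x)).
  exact: (integrableB measurableT is_ (Cb_integrable nu cf)).
apply: (le_trans (le_normr_Rintegral _ ifs)) => //.
rewrite -[leRHS](state_cst (state_integral nu)); apply: le_Rintegral => //.
- exact: integrable_norm ifs.
- exact: Cb_integrable (Cb_cst T e).
- by move=> x _; rewrite distrC.
Qed.

End rba_of_probability.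

(** Tight states are integrals, and hence pairings with an element of [rba]:
    tightness gives the Daniell property, the representing measure is outer
    regular, and an outer regular probability is a regular finitely additive
    measure. *)
Theorem tight_representation (R : realType) (E : completePMetricType R)
    (L : (seqspace E -> R) -> R) : state L -> tight L ->
  (exists nu : probability (borel (seqspace E)) R,
    forall f, Cb f -> L f = \int[nu]_x f x) /\
  (exists mu : rba R (seqspace E), forall f, Cb f -> pairing mu f = L f).
Proof.
move=> stL tL; have [nu nuL reg] :=
  daniell_representation stL (tight_daniell stL tL) (@metric_cozero_opens _ _).
split; first by exists nu.
by exists (rba_of_prob reg) => f cf; rewrite nuL// rba_of_prob_pairing.
Qed.

(** * The Ruelle operator *)

Lemma sequential_continuousR (R : realType) (M : metricType R) (f : M -> R) :
  (forall x (y : nat -> M), y n @[n --> \oo] --> x ->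
    f (y n) @[n --> \oo] --> f x) -> continuous f.
Proof.
move=> h x; apply/cvgrPdist_lt => e e0; apply: contrapT => nf.
have n0 (n : nat) : 0 < n.+1%:R^-1 :> R by rewrite invr_gt0.
have /choice[y yP] n : exists y, mdist x y < n.+1%:R^-1 /\ e <= `|f x - f y|.
  apply: contrapT => ny; apply: nf; apply/nbhs_ballP; exists n.+1%:R^-1 => //= y.
  rewrite ballEmdist /= => xy; rewrite ltNge; apply/negP => fxy.
  by apply: ny; exists y.
have yx : y n @[n --> \oo] --> x.
  apply/cvg_ballP => d d0; exists (Num.truncn d^-1) => // n /= dn.
  rewrite ballEmdist /=; apply: (lt_le_trans (yP n).1).
  rewrite invf_ple ?posrE// ltW// (lt_le_trans (truncnS_gt _))//.
  by rewrite ler_nat ltnS.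
have /cvgrPdist_lt /(_ e e0)[N _ /(_ N (leqnn N))] := h x y yx.
by rewrite ltNge (yP N).2.
Qed.

Lemma ultra_bounded_cvg (R : realType) (I : Type) (U : set_system I)
    (f : I -> R) (M : R) : UltraFilter U -> U [set i | `|f i| <= M] ->
  cvg (f i @[i --> U]).
Proof.
move=> UU fM; have UfU : UltraFilter (f @ U).
  split=> [|G PG fG]; first exact: fmap_proper_filter.
  apply/seteqP; split => // A GA; rewrite /fmap /=.
  have [//|UnA] := in_ultra_setVsetC (f @^-1` A) UU.
  have : G (A `&` ~` A) by apply: filterI => //; apply: fG.
  by rewrite setICr => /filter_not_empty.
have := @segment_compact R (- M) M; rewrite compact_ultra => /(_ _ UfU)[|l [_ fl]].
  by rewrite /fmap /=; apply: (@filterS _ U _ _ _ _ fM) => i /=; rewrite in_itv/= -ler_norml.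
by apply/cvg_ex; exists l.
Qed.

Section averaging.
Context (R : realType) (E : completePMetricType R).
Variable p : probability (borel E) R.
Local Notation X := (seqspace E).
Implicit Types (f g h phi : X -> R) (x y : X).

(** The Ruelle operator of the zero potential. *)
Definition avg h x : R := \int[p]_a h (scons a x).

Lemma Cb_scons h x : Cb h -> Cb (fun a => h (scons a x)).
Proof. by move=> ch; apply: (Cb_comp ch); exact: continuous_scons. Qed.

Lemma avg_state x : state (avg^~ x).
Proof.
split.
- move=> f g cf cg.
  exact: (stateD (state_integral p) (Cb_scons x cf) (Cb_scons x cg)).
- by move=> k f cf; exact: (stateZ (state_integral p) k (Cb_scons x cf)).
- move=> f cf f0; apply: (state_ge0 (state_integral p) (Cb_scons x cf)) => a.
  exact: f0.
- exact: (state1 (state_integral p)).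
Qed.

(** Continuity in the point is dominated convergence along sequences. *)
Lemma Cb_avg h : Cb h -> Cb (avg h).
Proof.
move=> ch; have [M M0 hM] := Cb_bound ch; apply/CbP; split; last first.
  by exists M => x; exact: (state_norm (avg_state x) ch).
apply: (@sequential_continuousR R X) => x y yx.
apply: (@Cb_dominated _ _ p (fun n a => h (scons a (y n))) _ M) => //.
- by move=> n; exact: Cb_scons.
- exact: Cb_scons.
- move=> a; apply: (cvg_comp y (fun z => h (scons a z)) yx).
  apply: (@continuous_comp _ _ _ (scons a : X -> X) h); first exact: continuous_sconsr.
  exact: Cb_continuous.
Qed.

Lemma avg_shift phi : avg (phi \o @Defs.shift E) = phi.
Proof. by apply/funext => x; exact: (state_cst (state_integral p) (phi x)). Qed.

Lemma avg_coord0 (b : E -> R) : avg (fun x => b (x 0%N)) = fun=> \int[p]_a b a.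
Proof. by []. Qed.

Lemma avg_coordS (b : E -> R) j : avg (fun x => b (x j.+1)) = fun x => b (x j).
Proof. exact: (avg_shift (fun x => b (x j))). Qed.

Lemma ruelle_avg g phi : ruelle p g phi = avg (fun x => expR (g x) * phi x).
Proof. by []. Qed.

(** The exponential lies above its tangent at [avg h x]. *)
Lemma avg_jensen h x : Cb h -> expR (avg h x) <= avg (fun y => expR (h y)) x.
Proof.
move=> ch; set c := avg h x.
have ce : Cb (fun y => expR (h y)) by exact: Cb_exp.
have cl : Cb (fun y => expR c * (h y + (1 - c))).
  by apply: CbZ; apply: CbD => //; exact: Cb_cst.
have : avg (fun y => expR c * (h y + (1 - c))) x <= avg (fun y => expR (h y)) x.
  apply: (state_le (avg_state x)) => // y.
  rewrite -[h y in leRHS](subrK c) expRD mulrC ler_wpM2r ?expR_ge0//.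
  by rewrite (le_trans _ (expR_ge1Dx _))//; lra.
have ccst : Cb (fun _ : X => 1 - c) by exact: Cb_cst.
have cs : Cb (fun y => h y + (1 - c)) by exact: CbD.
have := stateZ (avg_state x) (expR c) cs => /= ->.
have := stateD (avg_state x) ch ccst => /= ->.
by rewrite (state_cst (avg_state x)) -/c (_ : c + (1 - c) = 1) ?mulr1//; lra.
Qed.

Hypothesis sepE : separable E.

(** [F] consists of the first points of a dense sequence. *)
Lemma bump_small (eta delta : R) : 0 < eta -> 0 < delta ->
  exists F : seq E, \int[p]_a bump F eta a <= delta.
Proof.
move=> eta0 delta0; have [D cD dD] := sepE.
have [c cP] : exists c : nat -> E, D `<=` range c.
  have [D0|/set0P[d Dd]] := eqVneq D set0.
    by exists (fun=> point); rewrite D0.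
  have /pfcard_geP[D0|[c]] : (D #<= [set: nat])%card by [].
    by rewrite D0 in Dd.
  by exists c => y Dy; have [n _ <-] := @surj _ _ _ _ c y Dy; exists n.
pose F n := map c (iota 0 n).
have cvg0 a : bump (F n) eta a @[n --> \oo] --> (0 : R).
  apply/cvgrPdist_le => e e0.
  have ee : 0 < e * eta by rewrite mulr_gt0.
  have [||d [ad Dd]] := dD (ball a (e * eta))^°.
  - exists a; apply: nbhsx_ballx ee.
  - exact: open_interior.
  have [i _ ci] := cP d Dd.
  exists i.+1 => // n /= ni; rewrite sub0r normrN ger0_norm ?bump_ge0//.
  apply: (le_trans (@bump_mem _ _ (F n) eta a d _)).
    by apply/mapP; exists i => //; rewrite mem_iota add0n.
  rewrite ler_pdivrMr// ltW//; have := interior_subset ad.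
  by rewrite ballEmdist.
have := @Cb_dominated _ _ p (fun n => bump (F n) eta) (fun=> 0) 1.
have c0 : Cb (fun _ : E => 0 : R) by exact: Cb_cst.
move=> /(_ (fun n => Cb_bump (F n) eta0) c0).
move=> /(_ (fun n a => bump_norm (F n) a eta0) cvg0).
rewrite (state_cst (state_integral p)) => /cvgrPdist_le /(_ delta delta0)[N _].
move=> /(_ N (leqnn N)); rewrite sub0r normrN => /(le_trans (ler_norm _)) h.
by exists (F N).
Qed.

(** Averaging moves a function of the coordinate [j.+1] to the coordinate [j]
    and turns a function of the coordinate [0] into its mean under [p]; after
    [j.+1] steps the mass of a bump function is controlled by [p] alone. *)
Lemma avg_tight L C : state L -> 0 <= C ->
  (forall phi, Cb phi -> (forall x, 0 <= phi x) -> L phi <= C * L (avg phi)) ->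
  tight L.
Proof.
move=> stL C0 LC j eta delta eta0 delta0.
have Cj : 0 < C ^+ j.+1 + 1 by rewrite ltr_wpDl// exprn_ge0.
have [F hF] := bump_small eta0 (divr_gt0 delta0 Cj); exists F.
suff h : L (fun x => bump F eta (x j)) <= C ^+ j.+1 * \int[p]_a bump F eta a.
  apply: (le_trans h); apply: (@le_trans _ _ (C ^+ j.+1 * (delta / (C ^+ j.+1 + 1)))).
    by rewrite ler_wpM2l// exprn_ge0.
  by rewrite mulrCA ger_pMr// ler_pdivrMr// mul1r lerDl.
elim: j {Cj hF} => [|j IH].
  apply: (le_trans (LC _ (Cb_bump_coord F 0 eta0) _)).
    by move=> x; exact: bump_ge0.
  by rewrite avg_coord0 (state_cst stL) expr1.
apply: (le_trans (LC _ (Cb_bump_coord F j.+1 eta0) _)).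
  by move=> x; exact: bump_ge0.
by rewrite avg_coordS exprS -mulrA ler_wpM2l.
Qed.

End averaging.

(** * Eigenmeasures of the dual operator *)

(** A positive sequence that is multiplicative up to a constant is geometric up
    to the same constant: in the logarithmic scale, the numbers [(b n - k) / n]
    all lie below the numbers [(b m + k) / m]. *)
Lemma quasi_multiplicative (R : realType) (a : nat -> R) (K : R) :
  (forall n, 0 < a n) -> 1 <= K ->
  (forall n m, a (n + m)%N <= K * (a n * a m)) ->
  (forall n m, a n * a m <= K * a (n + m)%N) ->
  exists2 l : R, 0 < l & forall n, (0 < n)%N -> l ^+ n <= K * a n /\ a n <= K * l ^+ n.
Proof.
move=> a0 K1 aK Ka; have K0 : 0 < K by exact: lt_le_trans K1.
pose b n := ln (a n); pose k := ln K.
have k0 : 0 <= k by exact: ln_ge0.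
have lnle (x y : R) : 0 < x -> x <= y -> ln x <= ln y.
  by move=> x0 xy; rewrite ler_ln ?posrE// (lt_le_trans x0).
have bk n m : b (n + m)%N <= k + (b n + b m).
  rewrite /b -lnM ?posrE// -lnM ?posrE ?mulr_gt0//.
  exact: lnle.
have kb n m : b n + b m <= k + b (n + m)%N.
  rewrite /b -lnM ?posrE// -lnM ?posrE//.
  by apply: lnle => //; rewrite mulr_gt0.
have up m n : b (n.+1 * m)%N <= n.+1%:R * b m + n%:R * k.
  elim: n => [|n IH]; first by rewrite mul1n mul1r mul0r addr0.
  rewrite mulSn; apply: (le_trans (bk _ _)); move: IH.
  by move: (b (n.+1 * m)%N) (b m) => u v; rewrite -!natr1; lra.
have down m n : n.+1%:R * b m <= b (n.+1 * m)%N + n%:R * k.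
  elim: n => [|n IH]; first by rewrite mul1n mul1r mul0r addr0.
  rewrite mulSn; move: IH (kb m (n.+1 * m)%N).
  by move: (b (n.+1 * m)%N) (b (m + _)%N) (b m) => u w v; rewrite -!natr1; lra.
(* Compare [b] at [(n + 1) * (m + 1)], computed in blocks of either length. *)
pose S := [set (b n.+1 - k) / n.+1%:R | n in [set: nat]].
have bound n m : (b n.+1 - k) / n.+1%:R <= (b m.+1 + k) / m.+1%:R.
  rewrite ler_pdivrMr// mulrAC ler_pdivlMr//.
  have := down n.+1 m; have := up m.+1 n; rewrite mulnC.
  have -> : m.+1%:R = m%:R + 1 :> R by rewrite natr1.
  have -> : n.+1%:R = n%:R + 1 :> R by rewrite natr1.
  move: (b (m.+1 * n.+1)%N) (b m.+1) (b n.+1) (m%:R : R) (n%:R : R) => u v w s t.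
  nra.
have hS : has_sup S.
  split; first by exists ((b 1%N - k) / 1%:R), 0%N.
  by exists ((b 1%N + k) / 1%:R) => _ [n _ <-]; exact: bound n 0%N.
pose beta := sup S.
have lo n : b n.+1 - k <= beta * n.+1%:R.
  by rewrite -ler_pdivrMr//; apply: sup_upper_bound => //; exists n.
have hi n : beta * n.+1%:R <= b n.+1 + k.
  rewrite -ler_pdivlMr//; apply: ge_sup; first by case: hS.
  by move=> _ [m _ <-]; exact: bound.
exists (expR beta); first exact: expR_gt0.
case=> // n _; rewrite -expRM_natr.
split.
- rewrite -[K](lnK (_ : K \is Num.pos)) ?posrE// -[a n.+1]lnK ?posrE//.
  by rewrite -expRD ler_expR addrC; exact: hi.
- rewrite -[K](lnK (_ : K \is Num.pos)) ?posrE// -[a n.+1]lnK ?posrE//.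
  by rewrite -expRD ler_expR -lerBlDl; exact: lo.
Qed.

Section eigenmeasure.
Context (R : realType) (E : completePMetricType R) (sepE : separable E).
Context (p : probability (borel E) R) (alpha : R) (alpha0 : 0 < alpha).
Local Notation X := (seqspace E).
Local Notation avg := (avg p).
Implicit Types (f g h phi : X -> R) (x y : X).

Definition holder D g := forall x y, `|g x - g y| <= D * mdist x y `^ alpha.

(** The factor by which prepending a coordinate contracts [mdist ^ alpha]. *)
Definition rate : R := 2^-1 `^ alpha.

Lemma rate_gt0 : 0 < rate.
Proof. by rewrite powR_gt0 ?invr_gt0. Qed.

Lemma rate_lt1 : rate < 1.
Proof.
rewrite /rate [ltRHS](_ : 1 = 1 `^ alpha); last by rewrite powR1.
apply: (gt0_ltr_powR alpha0); rewrite ?nnegrE//.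
by rewrite invf_lt1// ltr1n.
Qed.


Lemma mdist_scons_rate a x y :
  mdist (scons a x : X) (scons a y) `^ alpha = rate * mdist x y `^ alpha.
Proof. by rewrite seqdist_scons powRM ?mdist_ge0// invr_ge0. Qed.

Lemma mdist_powR_le1 x y : mdist x y `^ alpha <= 1.
Proof.
rewrite [leRHS](_ : 1 = 1 `^ alpha); last by rewrite powR1.
apply: (ge0_ler_powR (ltW alpha0)); rewrite ?nnegrE ?mdist_ge0//.
exact: seqdist_le1.
Qed.

Lemma Hol_holder g : Hol alpha g -> Cb g /\ exists2 D, 0 <= D & holder D g.
Proof.
case=> cg Dg; split => //.
have [D DE] : exists D : R, (Dalpha alpha g <= D%:E)%E.
  move: Dg; case: (Dalpha alpha g) => [D _|//|_]; first by exists D.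
  by exists 0; rewrite leNye.
exists (Num.max 0 D); first by rewrite le_max lexx.
move=> x y; have [->|xy] := eqVneq x y.
  by rewrite subrr normr0 mulr_ge0 ?powR_ge0// le_max lexx.
have xy0 : 0 < mdist x y `^ alpha.
  rewrite powR_gt0// lt_neqAle mdist_ge0 andbT eq_sym.
  by apply: contra_neq xy => /mdist_positivity.
rewrite -ler_pdivrMr// le_max; apply/orP; right; rewrite -lee_fin.
by apply: le_trans DE; apply: ereal_sup_ubound; exists x, y.
Qed.

Lemma holder_avg D g : Cb g -> holder D g -> holder (D * rate) (avg g).
Proof.
move=> cg hg x y; rewrite -mulrA.
rewrite -(stateB (state_integral p)); [|exact: Cb_scons..].
apply: (state_norm (state_integral p)).
  by apply: CbB; exact: Cb_scons.
by move=> a; apply: (le_trans (hg _ _)); rewrite mdist_scons_rate.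
Qed.

End eigenmeasure.

Record positive_operator (R : realType) (T : topologicalType)
    (P : (T -> R) -> (T -> R)) : Prop := PositiveOperator {
  posop_Cb : forall f, Cb f -> Cb (P f) ;
  posopD : forall f g, Cb f -> Cb g ->
    P (fun x => f x + g x) = fun x => P f x + P g x ;
  posopZ : forall k f, Cb f -> P (fun x => k * f x) = fun x => k * P f x ;
  posop_ge0 : forall f, Cb f -> (forall x, 0 <= f x) -> forall x, 0 <= P f x
}.

Section positive_operators.
Context (R : realType) (T : topologicalType) (P : (T -> R) -> (T -> R)).
Hypothesis posP : positive_operator P.

Lemma posop_le f g : Cb f -> Cb g -> (forall x, f x <= g x) ->
  forall x, P f x <= P g x.
Proof.
move=> cf cg fg x; rewrite -subr_ge0.
have cN : Cb (fun y => -1 * f y) by exact: CbZ.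
have : 0 <= P (fun y => g y + -1 * f y) x.
  apply: (posop_ge0 posP); first exact: CbD.
  by move=> y; rewrite mulN1r subr_ge0.
by rewrite (posopD posP)// (posopZ posP)// mulN1r.
Qed.

Lemma posop_iter n : positive_operator (iter n P).
Proof.
elim: n => [|n IH]; first by split.
split=> /=.
- by move=> f cf; apply: (posop_Cb posP); exact: (posop_Cb IH).
- move=> f g cf cg; rewrite (posopD IH)// (posopD posP)//; exact: (posop_Cb IH).
- by move=> k f cf; rewrite (posopZ IH)// (posopZ posP)//; exact: (posop_Cb IH).
- move=> f cf f0 x; apply: (posop_ge0 posP); first exact: (posop_Cb IH).
  exact: (posop_ge0 IH).
Qed.

Lemma posop_norm f M : Cb f -> (forall x, `|f x| <= M) ->
  forall x, `|P f x| <= M * P (fun=> 1) x.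
Proof.
move=> cf fM x; have c1 : Cb (fun _ : T => 1 : R) by exact: Cb_cst.
have E k : k * P (fun=> 1) x = P (fun _ => k * 1) x by rewrite (posopZ posP).
rewrite ler_norml -mulNr !E; apply/andP; split; apply: posop_le => //; (try exact: CbZ) => y.
- by have := fM y; rewrite ler_norml mulr1 => /andP[].
- by have := fM y; rewrite ler_norml mulr1 => /andP[].
Qed.

End positive_operators.

Section eigenmeasure_existence.
Context (R : realType) (E : completePMetricType R) (sepE : separable E).
Context (p : probability (borel E) R) (alpha : R) (alpha0 : 0 < alpha).
Local Notation X := (seqspace E).
Local Notation avg := (avg p).
Implicit Types (f g h phi : X -> R) (x y : X).

Lemma ruelle_positive g : Cb g -> positive_operator (ruelle p g).
Proof.
move=> cg; have ce : Cb (fun x => expR (g x)) by exact: Cb_exp.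
split.
- by move=> f cf; rewrite ruelle_avg; apply: Cb_avg; exact: CbM.
- move=> f h cf ch; rewrite !ruelle_avg; apply/funext => x.
  rewrite -(stateD (avg_state p x)); [|exact: CbM..].
  by congr (avg _ x); apply/funext => y; rewrite mulrDr.
- move=> k f cf; rewrite !ruelle_avg; apply/funext => x.
  rewrite -(stateZ (avg_state p x)); [|exact: CbM..].
  by congr (avg _ x); apply/funext => y; rewrite mulrCA.
- move=> f cf f0 x; rewrite ruelle_avg.
  apply: (state_ge0 (avg_state p x)); first exact: CbM.
  by move=> y; rewrite mulr_ge0 ?expR_ge0.
Qed.

Section fixed_potential.
Variables (g : X -> R) (D : R).
Hypotheses (cg : Cb g) (D0 : 0 <= D) (hg : holder alpha D g).
Let P := ruelle p g.
Let posP : positive_operator P := ruelle_positive cg.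
Let u n := iter n P (fun=> 1).
Let c1 : Cb (fun _ : X => 1 : R). Proof. exact: Cb_cst. Qed.
Let cu n : Cb (u n). Proof. exact: (posop_Cb (posop_iter posP n)). Qed.
Let ce : Cb (fun x => expR (g x)). Proof. exact: Cb_exp. Qed.

Let u_gt0 n x : 0 < u n x.
Proof.
have [M M0 gM] := Cb_bound cg.
suff [c c0 cun] : exists2 c, 0 < c & forall x, c <= u n x.
  exact: lt_le_trans (cun x).
elim: n => [|n [c c0 cun]]; first by exists 1.
exists (expR (- M) * c); first by rewrite mulr_gt0 ?expR_gt0.
move=> y; rewrite /u iterS -/(u n) /P ruelle_avg.
apply: (state_lbound (avg_state p y)); first exact: CbM.
move=> z; apply: ler_pM => //; rewrite ?expR_ge0 ?(ltW c0)//.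
by rewrite ler_expR; have := gM z; rewrite ler_norml => /andP[].
Qed.

Let B := D * rate alpha / (1 - rate alpha).

Let B_ge0 : 0 <= B.
Proof.
by rewrite /B divr_ge0 ?mulr_ge0// ?subr_ge0 ltW ?rate_gt0 ?rate_lt1.
Qed.

(** Bounded distortion: the constant [B] is the fixed point of
    [b |-> (D + b) * rate], by which one application of the operator changes
    the oscillation of the logarithm. *)
Let distortion n x y : u n x <= u n y * expR (B * mdist x y `^ alpha).
Proof.
elim: n x y => [|n IH] x y.
  by rewrite /u /= mul1r -[leLHS]expR0 ler_expR mulr_ge0// powR_ge0.
rewrite /u iterS -/(u n) /P ruelle_avg mulrC.
have cm : Cb (fun x => expR (g x) * u n x) by exact: CbM.
have <- := stateZ (avg_state p y) (expR (B * mdist x y `^ alpha)) cm.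
have kcm := CbZ (expR (B * mdist x y `^ alpha)) cm.
apply: (state_le (state_integral p) (Cb_scons x cm) (Cb_scons y kcm)) => a /=.
 set x' := scons a x; set y' := scons a y.
have r1 := rate_lt1 alpha0; have r0 := rate_gt0 alpha.
have -> : B * mdist x y `^ alpha = D * mdist x' y' `^ alpha + B * mdist x' y' `^ alpha.
  rewrite mdist_scons_rate /B.
  have : 1 - rate alpha != 0 by rewrite subr_eq0 gt_eqF.
  move: (rate alpha) (mdist x y `^ alpha) => r d hr; field.
  by rewrite hr.
rewrite expRD mulrACA; apply: ler_pM; rewrite ?expR_ge0 ?(ltW (u_gt0 _ _))//.
  rewrite -expRD ler_expR -lerBlDr.
  by apply: (le_trans (ler_norm _)); exact: hg.
by rewrite mulrC; exact: IH.
Qed.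

Let K := expR B.
Let K_ge1 : 1 <= K. Proof. by rewrite -expR0 ler_expR. Qed.
Let K_gt0 : 0 < K. Proof. exact: expR_gt0. Qed.

(** The metric is bounded by [1], so the distortion is uniformly bounded. *)
Let harnack n x y : u n x <= K * u n y.
Proof.
apply: (le_trans (distortion n x y)); rewrite mulrC ler_wpM2r//.
  exact: ltW.
by rewrite ler_expR ler_piMr// mdist_powR_le1.
Qed.

Let x0 : X := fun=> point.
Let a n := u n x0.

(** By [harnack] the values at the base point are quasi-multiplicative. *)
Let growth : exists2 l : R, 0 < l &
  forall n, l ^+ n <= K * a n /\ a n <= K * l ^+ n.
Proof.
have [||n m|n m|l l0 al] := @quasi_multiplicative R a K.
- by move=> n; exact: u_gt0.
- exact: K_ge1.
- rewrite /a {1}/u iterD -/(u m).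
  have -> : K * (u n x0 * u m x0) = (K * u m x0) * iter n P (fun=> 1) x0.
    by rewrite mulrA mulrAC.
  have := posopZ (posop_iter posP n) (K * u m x0) c1 => /(congr1 (fun f => f x0)) <-.
  apply: (posop_le (posop_iter posP n)) => //; first exact: CbZ.
  by move=> x; rewrite mulr1; exact: harnack.
- rewrite /a [u (n + m)]/u iterD -/(u m) mulrC.
  have := posopZ (posop_iter posP n) (u m x0) c1 => /(congr1 (fun f => f x0)) <-.
  have := posopZ (posop_iter posP n) K (cu m) => /(congr1 (fun f => f x0)) <-.
  apply: (posop_le (posop_iter posP n)) => //; [exact: CbZ|exact: CbZ|].
  by move=> x; rewrite mulr1; exact: harnack.
exists l => // -[|n]; last exact: al.
by rewrite expr0 /a /u /= mulr1.
Qed.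

(** The eigenmeasure is a limit, along an ultrafilter, of Cesaro means of the
    normalised iterates at a base point; they are bounded by [growth].  The
    eigenvalue relation says that the means are asymptotically invariant, and
    tightness follows from the comparison [ruelle g phi <= e^M * avg phi]. *)
Lemma eigenstate_exists : exists2 l : R, 0 < l & exists L : (X -> R) -> R,
  [/\ state L, tight L & forall phi, Cb phi -> L (P phi) = l * L phi].
Proof.
have [l l0 al] := growth; exists l => //.
have ln0 n : 0 < l ^+ n by rewrite exprn_gt0.
pose c n phi := (l ^+ n)^-1 * iter n P phi x0.
have c_norm n phi M : Cb phi -> (forall x, `|phi x| <= M) -> `|c n phi| <= K * M.
  move=> cp pM; rewrite /c normrM gtr0_norm ?invr_gt0// ler_pdivrMl//.
  apply: (le_trans (posop_norm (posop_iter posP n) cp pM x0)).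
  have M0 : 0 <= M by exact: le_trans (pM x0).
  rewrite -/(u n) -/(a n) mulrCA mulrA (mulrC M) ler_wpM2r//.
  exact: (al n).2.
pose S phi N := (\sum_(n < N.+1) c n phi) / N.+1%:R.
have N0 (N : nat) : 0 < N.+1%:R :> R by [].
have S_norm phi M N : Cb phi -> (forall x, `|phi x| <= M) -> `|S phi N| <= K * M.
  move=> cp pM; rewrite /S normrM (gtr0_norm (_ : 0 < N.+1%:R^-1)) ?invr_gt0//.
  rewrite ler_pdivrMr//; apply: (le_trans (ler_norm_sum _ _ _)).
  apply: (@le_trans _ _ (\sum_(n < N.+1) K * M)).
    by apply: ler_sum => n _; exact: c_norm.
  by rewrite sumr_const card_ord mulr_natr.
have [U [UU Uoo]] := @ultraFilterLemma nat \oo _.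
have S_cvg phi : Cb phi -> cvg (S phi N @[N --> U]).
  move=> cp; have [M M0 pM] := Cb_bound cp.
  by apply: (ultra_bounded_cvg UU); apply: (@filterE _ U) => N; exact: S_norm pM.
pose Lam phi := lim (S phi N @[N --> U]).
have cD n phi psi : Cb phi -> Cb psi ->
    c n (fun x => phi x + psi x) = c n phi + c n psi.
  by move=> cp cq; rewrite /c (posopD (posop_iter posP n))// mulrDr.
have cZ n k phi : Cb phi -> c n (fun x => k * phi x) = k * c n phi.
  by move=> cp; rewrite /c (posopZ (posop_iter posP n))// mulrCA.
have LamD phi psi : Cb phi -> Cb psi ->
    Lam (fun x => phi x + psi x) = Lam phi + Lam psi.
  move=> cp cq; rewrite /Lam -limD; [|exact: S_cvg..].
  congr (lim (_ @ U)); apply/funext => N.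
  transitivity (S phi N + S psi N) => //; rewrite /S -mulrDl -big_split/=.
  by congr (_ / _); apply: eq_bigr => n _; rewrite cD.
have LamZ k phi : Cb phi -> Lam (fun x => k * phi x) = k * Lam phi.
  move=> cp; apply: cvg_lim => //.
  rewrite (_ : S _ = fun N => k * S phi N).
    by apply: cvgM; [exact: cvg_cst|exact: S_cvg].
  apply/funext => N; rewrite /S mulrA mulr_sumr.
  by congr (_ / _); apply: eq_bigr => n _; rewrite cZ.
have Lam0 phi : Cb phi -> (forall x, 0 <= phi x) -> 0 <= Lam phi.
  move=> cp p0; apply: limr_ge; first exact: S_cvg.
  apply: (@filterE _ U) => N; rewrite divr_ge0// sumr_ge0// => n _.
  rewrite mulr_ge0 ?invr_ge0 ?(ltW (ln0 n))//.
  exact: (posop_ge0 (posop_iter posP n)).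
have Lam1 : 0 < Lam (fun=> 1).
  apply: (@lt_le_trans _ _ K^-1); first by rewrite invr_gt0.
  apply: limr_ge; first exact: S_cvg.
  apply: (@filterE _ U) => N; rewrite ler_pdivlMr//.
  apply: (@le_trans _ _ (\sum_(n < N.+1) K^-1)).
    by rewrite sumr_const card_ord mulr_natr.
  apply: ler_sum => n _; rewrite /c -/(u n) -/(a n) mulrC ler_pdivlMr//.
  by rewrite ler_pdivrMl//; exact: (al n).1.
have LamP phi : Cb phi -> Lam (P phi) = l * Lam phi.
  move=> cp; have [M M0 pM] := Cb_bound cp.
  have cPp : Cb (P phi) by exact: (posop_Cb posP).
  (* Applying [P] shifts the Cesaro mean; all but two terms cancel. *)
  have SP N : S (P phi) N - l * S phi N = l * (c N.+1 phi - c 0%N phi) / N.+1%:R.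
    rewrite /S mulrA -mulrBl; congr (_ / _).
    rewrite mulr_sumr -sumrB mulrBr.
    rewrite -(big_mkord xpredT (fun n => c n (P phi) - l * c n phi)).
    rewrite -(telescope_sumr (fun n => l * c n phi))//; apply: eq_bigr => n _.
    by rewrite /c -iterSr exprS invfM !mulrA divff ?gt_eqF// mul1r.
  have d0 : S (P phi) N - l * S phi N @[N --> U] --> (0 : R).
    apply/cvgrPdist_le => e e0; apply: Uoo.
    exists (Num.truncn (l * (2 * (K * M)) / e)) => // N /= eN.
    rewrite sub0r normrN SP normrM (gtr0_norm (_ : 0 < N.+1%:R^-1)) ?invr_gt0//.
    rewrite normrM (gtr0_norm l0) ler_pdivrMr//.
    apply: (@le_trans _ _ (l * (2 * (K * M)))).
      rewrite ler_pM2l// (le_trans (ler_normB _ _))// mulr_natl mulr2n.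
      by rewrite lerD// c_norm.
    rewrite [e * _]mulrC -ler_pdivrMr// ltW// (lt_le_trans (truncnS_gt _))//.
    by rewrite ler_nat ltnS.
  apply: cvg_lim => //; rewrite -[X in _ --> X]add0r.
  rewrite (_ : S _ = fun N => (S (P phi) N - l * S phi N) + l * S phi N).
    by apply: cvgD => //; apply: cvgM; [exact: cvg_cst|exact: S_cvg].
  by apply/funext => N; rewrite subrK.
have LamN : Lam (fun=> 1) != 0 by rewrite gt_eqF.
pose L phi := Lam phi / Lam (fun=> 1).
have stL : state L.
  split.
  - by move=> f h cf ch; rewrite /L LamD// mulrDl.
  - by move=> k f cf; rewrite /L LamZ// mulrA.
  - by move=> f cf f0; rewrite /L divr_ge0// ?Lam0// ltW.
  - by rewrite /L divff.
have LP phi : Cb phi -> L (P phi) = l * L phi.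
  by move=> cp; rewrite /L LamP// mulrA.
exists L; split => //.
have [M M0 gM] := Cb_bound cg.
apply: (@avg_tight _ _ p sepE L (expR M / l)) => //.
  by rewrite divr_ge0 ?expR_ge0// ltW.
move=> phi cp p0; rewrite mulrAC ler_pdivlMr// mulrC -LP//.
have ca : Cb (avg phi) by exact: Cb_avg.
rewrite -(stateZ stL)//; apply: (state_le stL).
- exact: (posop_Cb posP).
- exact: CbZ.
move=> x; rewrite /P ruelle_avg -(stateZ (avg_state p x))//.
apply: (state_le (avg_state p x)); [exact: CbM|exact: CbZ|].
move=> y; rewrite ler_wpM2r// ler_expR.
by rewrite (le_trans (ler_norm _)).
Qed.

End fixed_potential.

(** [lambda] is a chosen value; this makes it an eigenvalue, by representing the
    state of [eigenstate_exists] as a probability. *)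
Lemma lambda_spec g : Hol alpha g -> 0 < lambda p g /\
  exists nu : probability (borel X) R, dual_eigen p g nu (lambda p g).
Proof.
move=> Hg; apply: (getPex (P := [set lam | 0 < lam /\
  exists nu : probability (borel X) R, dual_eigen p g nu lam])).
have [cg [D D0 hg]] := Hol_holder Hg.
have [l l0 [L [stL tL LP]]] := eigenstate_exists cg D0 hg.
have [[nu nuL] _] := tight_representation stL tL.
exists l; split => //; exists nu => phi cp.
rewrite -!nuL ?LP//; exact: (posop_Cb (ruelle_positive cg)).
Qed.

(** The eigenstate of the zero potential, whose eigenvalue is [1]. *)
Lemma stationary_state : exists L : (X -> R) -> R,
  [/\ state L, tight L & forall phi, Cb phi -> L (avg phi) = L phi].
Proof.
have c0 : Cb (fun _ : X => 0 : R) by exact: Cb_cst.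
have c1 : Cb (fun _ : X => 1 : R) by exact: Cb_cst.
have h0 : holder alpha 0 (fun _ : X => 0 : R).
  by move=> x y; rewrite subrr normr0 mul0r.
have [l l0 [L [stL tL LP]]] := eigenstate_exists c0 (lexx 0) h0.
have ravg phi : ruelle p (fun=> 0) phi = avg phi.
  by rewrite ruelle_avg; congr (avg _); apply/funext => x; rewrite expR0 mul1r.
have l1 : l = 1.
  have := LP _ c1; rewrite ravg (state1 stL) mulr1 => <-.
  rewrite (_ : avg _ = fun=> 1) ?(state1 stL)//.
  by apply/funext => x; exact: state1 (avg_state p x).
by exists L; split => // phi cp; rewrite -ravg LP// l1 mul1r.
Qed.

End eigenmeasure_existence.

(** * Equilibrium states *)

Section variational_bound.
Context (R : realType) (E : completePMetricType R) (sepE : separable E).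
Context (p : probability (borel E) R) (alpha : R) (alpha0 : 0 < alpha).
Local Notation X := (seqspace E).
Local Notation avg := (avg p).
Implicit Types (f g h phi : X -> R) (x y : X).

Variables (g : X -> R) (L : (X -> R) -> R).
Hypotheses (Hg : Hol alpha g) (stL : state L).
Hypothesis L_avg : forall phi, Cb phi -> L (avg phi) = L phi.
Let cg : Cb g := proj1 Hg.
Let cit n : Cb (iter n avg g).
Proof. by elim: n => [|n IH] //=; exact: Cb_avg. Qed.

Let Lit n : L (iter n avg g) = L g.
Proof. by elim: n => [//|n IH]; rewrite iterS L_avg. Qed.

Let u n x := \sum_(k < n) (iter k.+1 avg g x - L g).
Let cu n : Cb (u n).
Proof. by apply: Cb_sum => k; apply: CbB => //; exact: Cb_cst. Qed.

Let avg_u n x : avg (fun y => g y + u n y) x = u n x + iter n.+1 avg g x.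
Proof.
elim: n => [|n IH].
  rewrite /u big_ord0 add0r; congr (avg _ x); apply/funext => y.
  by rewrite big_ord0 addr0.
have cgu : Cb (fun y => g y + u n y) by exact: CbD.
have cv : Cb (fun y => iter n.+1 avg g y - L g) by apply: CbB => //; exact: Cb_cst.
rewrite (_ : (fun y => _) = fun y => (g y + u n y) + (iter n.+1 avg g y - L g)).
  rewrite (stateD (avg_state p x) cgu cv) IH.
  rewrite (stateB (avg_state p x)) ?(state_cst (avg_state p x))//; last exact: Cb_cst.
  by rewrite [u n.+1 x]/u big_ord_recr/= -/(u n x); lra.
by apply/funext => y; rewrite [u n.+1 y]/u big_ord_recr/= -/(u n y) addrA.
Qed.

(** With [u = sum_(1 <= k <= n) (avg^k g - L g)], Jensen's inequality gives
    [ruelle g (exp u) >= exp (avg (g + u)) = exp (u + avg^(n+1) g)], and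
    [avg^(n+1) g] is uniformly close to its mean [L g].  Integrating against an
    eigenmeasure compares the eigenvalue with [exp (L g)]. *)
Lemma stationary_le_ln_lambda : L g <= ln (lambda p g).
Proof.
have [lam0 [nu nueig]] := lambda_spec sepE p alpha0 Hg.
have [_ [D D0 hg]] := Hol_holder Hg.
have r0 := rate_gt0 alpha; have r1 := rate_lt1 alpha0.
have hit n : holder alpha (D * rate alpha ^+ n) (iter n avg g).
  elim: n => [|n IH]; first by rewrite mulr1.
  by rewrite exprSr mulrA /=; exact: holder_avg.
have near n x : L g - D * rate alpha ^+ n <= iter n avg g x.
  rewrite lerBlDr -{1}(Lit n); apply: (state_ubound stL) => // y.
  rewrite -lerBlDl; apply: (le_trans (ler_norm _)); apply: (le_trans (hit n y x)).
  by rewrite ler_piMr ?mdist_powR_le1// mulr_ge0// exprn_ge0// ltW.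
have key n : L g - D * rate alpha ^+ n.+1 <= ln (lambda p g).
  set d := L g - _.
  have ceu : Cb (fun x => expR (u n x)) by exact: Cb_exp.
  have ced : Cb (fun x => expR d * expR (u n x)) by exact: CbZ.
  have sI := state_integral nu.
  have cP : Cb (ruelle p g (fun x => expR (u n x))).
    by apply: (posop_Cb (ruelle_positive p cg)).
  have h : expR d * \int[nu]_x expR (u n x) <=
      lambda p g * \int[nu]_x expR (u n x).
    rewrite -nueig// -(stateZ sI _ ceu); apply: (state_le sI ced cP) => x.
    rewrite -expRD ruelle_avg; apply: (@le_trans _ _ (expR (avg (fun y => g y + u n y) x))).
      by rewrite ler_expR avg_u addrC lerD2l; exact: near.
    rewrite (_ : (fun y => expR (g y) * _) = fun y => expR (g y + u n y)).
      by apply: avg_jensen; exact: CbD.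
    by apply/funext => y; rewrite expRD.
  have pos : 0 < \int[nu]_x expR (u n x).
    have [M M0 uM] := Cb_bound (cu n).
    apply: (@lt_le_trans _ _ (expR (- M))); first exact: expR_gt0.
    apply: (state_lbound sI ceu) => x; rewrite ler_expR.
    by have := uM x; rewrite ler_norml => /andP[].
  by rewrite -ler_expR lnK ?posrE//; rewrite ler_pM2r in h.
have rcvg : L g - D * rate alpha ^+ n.+1 @[n --> \oo] --> L g - D * 0.
  apply: cvgB; [exact: cvg_cst|apply: cvgM; first exact: cvg_cst].
  rewrite (cvg_shiftS (fun n => rate alpha ^+ n)); apply: cvg_expr.
  by rewrite ger0_norm// ltW.
rewrite mulr0 subr0 in rcvg.
by apply: (cvgr_to_le rcvg); exact: nearW.
Qed.

End variational_bound.

Section equilibrium.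
Context (R : realType) (E : completePMetricType R) (sepE : separable E).
Context (p : probability (borel E) R) (alpha : R).
Context (alpha0 : 0 < alpha) (alpha1 : alpha < 1).
Local Notation X := (seqspace E).
Local Notation avg := (avg p).
Variables (f : X -> R) (cf : Cb f).
Implicit Types (mu : rba R X) (g phi : X -> R).

Lemma holder_Hol g D : Cb g -> holder alpha D g -> Hol alpha g.
Proof.
move=> cg hg; split => //; apply: (@le_lt_trans _ _ D%:E); last exact: ltry.
apply: ge_ereal_sup => _ [x [y [xy ->]]]; rewrite lee_fin ler_pdivrMr//.
rewrite powR_gt0// lt_neqAle mdist_ge0 andbT eq_sym.
by apply: contra_neq xy => /mdist_positivity.
Qed.

Lemma Hol0 : Hol alpha (fun _ : X => 0 : R).
Proof.
apply: (@holder_Hol _ 0); first exact: Cb_cst.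
by move=> x y; rewrite subrr normr0 mul0r.
Qed.

Lemma Hol_bump F (eta C : R) : 0 < eta -> 0 <= C ->
  Hol alpha (fun x : X => C * bump F eta (x 0%N)).
Proof.
move=> eta0 C0; pose K := C * (1 + eta^-1) * 2.
apply: (@holder_Hol _ K); first by apply: CbZ; exact: Cb_bump_coord.
move=> x y; rewrite -mulrBr normrM (ger0_norm C0).
have ei : 0 <= eta^-1 by rewrite invr_ge0 ltW.
have h1 := bump_lip F (x 0%N) (y 0%N) eta0.
have h2 : `|bump F eta (x 0%N) - bump F eta (y 0%N)| <= 1.
  have /andP[? ?] := bump01 F (x 0%N) eta0; have /andP[? ?] := bump01 F (y 0%N) eta0.
  by rewrite ler_norml; apply/andP; split; lra.
have h3 := coord_lip 0 x y; rewrite expr1 in h3.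
have h4 : mdist x y <= mdist x y `^ alpha.
  have [->|xy] := eqVneq (mdist x y) 0; first exact: powR_ge0.
  apply: ger1_powR; last exact: ltW.
  by rewrite lt_neqAle eq_sym xy mdist_ge0 seqdist_le1.
have h5 : `|bump F eta (x 0%N) - bump F eta (y 0%N)| <=
    (1 + eta^-1) * Num.min (mdist (x 0%N) (y 0%N)) 1.
  have d0 := mdist_ge0 (x 0%N) (y 0%N).
  by case: (leP (mdist (x 0%N) (y 0%N)) 1) => d1; nra.
rewrite /K -!mulrA ler_wpM2l//; apply: (le_trans h5); rewrite ler_wpM2l ?addr_ge0//.
by apply: (le_trans h3); rewrite ler_pM2l.
Qed.

Lemma Cb_shift phi : Cb phi -> Cb (phi \o @Defs.shift E).
Proof. by move=> cp; apply: (Cb_comp cp); exact: continuous_shift. Qed.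

Lemma Msigma_state mu : Msigma mu -> state (pairing mu).
Proof. by case=> m _; exact/pairing_state. Qed.

Lemma hv_ge mu (r : R) : ((r%:E <= hv p alpha mu)%E) <->
  (forall g, Hol alpha g -> r <= - pairing mu g + ln (lambda p g)).
Proof.
split=> [rh g Hg|h].
  rewrite -lee_fin; apply: (le_trans rh); apply: ereal_inf_lbound.
  by exists g.
by apply: le_ereal_inf_tmp => _ [g Hg <-]; rewrite lee_fin; exact: h.
Qed.

Lemma hv_add_ge mu (r c : R) : ((r%:E <= hv p alpha mu + c%:E)%E) <->
  (forall g, Hol alpha g -> r <= - pairing mu g + ln (lambda p g) + c).
Proof.
rewrite -leeBlDr// -EFinB; split=> [/hv_ge h g Hg|h].
  by rewrite -lerBlDr; exact: h.
by apply/hv_ge => g Hg; rewrite lerBlDr; exact: h.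
Qed.

(** The zero potential gives an upper bound; a stationary state of the averaging
    operator, whose entropy is nonnegative, gives a lower bound. *)
Lemma pressure_fin : pressure p alpha f \is a fin_num.
Proof.
have [M M0 fM] := Cb_bound cf.
have upper : (pressure p alpha f <= (ln (lambda p (fun _ : X => 0)) + M)%:E)%E.
  apply: ge_ereal_sup => _ [mu mum <-]; rewrite EFinD; apply: leeD.
    apply: ereal_inf_lbound; exists (fun=> 0); first exact: Hol0.
    by rewrite (state_cst (Msigma_state mum)) oppr0 add0r.
  rewrite lee_fin; apply: (state_ubound (Msigma_state mum)) => // x.
  by rewrite (le_trans (ler_norm _)).
have lower : ((- M)%:E <= pressure p alpha f)%E.
  have [L [stL tL La]] := stationary_state sepE p alpha0.
  have [_ [mu muL]] := tight_representation stL tL.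
  have mum : Msigma mu.
    split.
      split; first by rewrite muL ?(state1 stL)//; exact: Cb_cst.
      by move=> h ch h0; rewrite muL//; exact: (state_ge0 stL).
    move=> h ch; rewrite !muL//; last exact: Cb_shift.
    by rewrite -La ?avg_shift//; exact: Cb_shift.
  apply: (@le_trans _ _ (hv p alpha mu + (pairing mu f)%:E)%E); last first.
    by apply: ereal_sup_ubound; exists mu.
  apply/hv_add_ge => g Hg; rewrite !muL//; last by case: Hg.
  have := stationary_le_ln_lambda sepE alpha0 Hg stL La.
  have := state_norm stL cf fM; rewrite ler_norml => /andP[? ?] ?; lra.
rewrite fin_real// (lt_le_trans _ lower) ?ltNyr//=.
by rewrite (le_lt_trans upper)// ltry.
Qed.

Let P := fine (pressure p alpha f).

(** Equilibrium states are cut out of [Msigma] by inequalities that are affine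
    and weak-* continuous in [mu], one for each potential. *)
Lemma equilibriumP mu : equilibrium p alpha f mu <-> Msigma mu /\
  forall g, Hol alpha g -> P <= - pairing mu g + ln (lambda p g) + pairing mu f.
Proof.
have PE : pressure p alpha f = P%:E by rewrite /P fineK// pressure_fin.
split=> -[mum h]; split => //.
  by apply/hv_add_ge; rewrite h PE.
apply/eqP; rewrite eq_le; apply/andP; split.
  by apply: ereal_sup_ubound; exists mu.
by rewrite PE; exact/hv_add_ge.
Qed.



(** Test the eigenvalue equation on the constant function [1]. *)
Lemma lambda_cst g Z : Hol alpha g -> (forall x, ruelle p g (fun=> 1) x = Z) ->
  lambda p g = Z.
Proof.
move=> Hg gZ; have [_ [nu nueig]] := lambda_spec sepE p alpha0 Hg.
have := nueig _ (Cb_cst X 1); have -> : ruelle p g (fun=> 1) = fun=> Z.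
  by apply/funext => x; exact: gZ.
have sI := state_integral nu.
by rewrite (state_cst sI Z) (state_cst sI 1) mulr1.
Qed.

(** Potentials [C * bump F eta (x 0)] with a large [C] force the mass of
    [bump F eta (x 0)] to be small, since their eigenvalue is
    [\int expR (C * bump F eta) dp], which is at most [2] for a suitable [F]. *)
Lemma equilibrium_tight j (eta delta : R) : 0 < eta -> 0 < delta ->
  exists F : seq E, forall mu, equilibrium p alpha f mu ->
    pairing mu (fun x => bump F eta (x j)) <= delta.
Proof.
move=> eta0 delta0; have [M M0 fM] := Cb_bound cf.
pose k := `|1 + M - P| + 1; have k0 : 0 < k by rewrite /k ltr_wpDl.
(* [k] bounds [C] times the mass to be estimated, whatever [C] is. *)
pose C := k / delta; have C0 : 0 < C by rewrite /C divr_gt0.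
have W0 : 0 < (C * expR C)^-1 by rewrite invr_gt0 mulr_gt0 ?expR_gt0.
have [F hF] := bump_small p sepE eta0 W0; exists F => mu /equilibriumP[mum muP].
have cb i : Cb (fun x : X => bump F eta (x i)) by exact: Cb_bump_coord.
(* By shift invariance only the coordinate [0] matters. *)
have -> : pairing mu (fun x => bump F eta (x j)) =
    pairing mu (fun x => bump F eta (x 0%N)).
  elim: j => [//|j <-].
  by case: mum => _ /(_ _ (cb j)) <-.
pose g (x : X) := C * bump F eta (x 0%N).
have Hg : Hol alpha g by exact: Hol_bump (ltW C0).
have cbF : Cb (bump F eta) by exact: Cb_bump.
have ceF : Cb (fun a => expR (C * bump F eta a)) by apply: Cb_exp; exact: CbZ.
have sI := state_integral p.
pose Z := \int[p]_a expR (C * bump F eta a).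
have gZ : lambda p g = Z.
  apply: lambda_cst => // x; apply: eq_Rintegral => a _.
  by rewrite mulr1.
have Z2 : Z <= 2.
  have cst1 : Cb (fun _ : E => 1 : R) by exact: Cb_cst.
  have cbb : Cb (fun a => C * expR C * bump F eta a) by exact: CbZ.
  have h : Z <= \int[p]_a (1 + C * expR C * bump F eta a).
    apply: (state_le sI ceF (CbD cst1 cbb)) => a.
    set b := bump F eta a; have /andP[b0 b1] : 0 <= b <= 1 by exact: bump01.
    (* [1 - s <= expR (- s)] multiplied by [expR s] gives
       [expR s <= 1 + s * expR s], with [s = C * b]. *)
    have h1 : 1 - C * b <= expR (- (C * b)) by exact: expR_ge1Dx.
    have h2 : expR (C * b) <= expR C by rewrite ler_expR ler_piMr// ltW.
    have h3 : expR (C * b) * expR (- (C * b)) = 1 by rewrite -expRD subrr expR0.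
    have h4 := expR_gt0 (C * b).
    have h5 := ler_wpM2l (ltW h4) h1; rewrite h3 in h5.
    have h6 := ler_wpM2l (mulr_ge0 (ltW C0) b0) h2.
    lra.
  apply: (le_trans h); have := stateD sI cst1 cbb => /= ->.
  have := stateZ sI (C * expR C) cbF => /= ->.
  rewrite (state_cst sI 1) (_ : 2 = 1 + 1)// lerD2l.
  by rewrite -ler_pdivlMl ?mulr1// mulr_gt0 ?expR_gt0.
have Z0 : 0 < Z by rewrite -gZ; have [] := lambda_spec sepE p alpha0 Hg.
have lnZ : ln Z <= 1.
  have -> : Z = 1 + (Z - 1) by lra.
  by apply: (le_trans (le_ln1Dx _)); lra.
have stm := Msigma_state mum.
have := muP g Hg; rewrite gZ /g (stateZ stm)//.
have := state_norm stm cf fM; rewrite ler_norml => /andP[_ fmu] h.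
have hk : C * pairing mu (fun x => bump F eta (x 0%N)) <= k.
  by rewrite /k; have := ler_norm (1 + M - P); lra.
by rewrite -(ler_pM2l C0) (le_trans hk)// /C divfK// gt_eqF.
Qed.

Lemma equilibrium_convex : convex_set (equilibrium p alpha f).
Proof.
move=> mu nu k /set_mem mueq /set_mem nueq; apply/mem_set.
have /equilibriumP[mum muP] := mueq; have /equilibriumP[num nuP] := nueq.
pose s : R := k%:num; pose t : R := 1 - s.
have s0 : 0 <= s by rewrite /s; exact: ge0.
have t0 : 0 <= t by rewrite /t subr_ge0 /s; exact: le1.
have st1 : s + t = 1 by rewrite /t; lra.
suff : equilibrium p alpha f (s *: mu + t *: nu) by [].
have prE h (ch : Cb h) := pairing_linear mu nu s t ch.
apply/equilibriumP; split.
  have [mua mus] := mum; have [nua nus] := num.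
  split.
    split; first by rewrite prE ?mua.1 ?nua.1 ?mulr1//; exact: Cb_cst.
    by move=> h ch h0; rewrite prE// addr_ge0// mulr_ge0 ?mua.2 ?nua.2.
  by move=> h ch; rewrite !prE ?mus ?nus//; exact: Cb_shift.
move=> g Hg; have cg := proj1 Hg; rewrite !prE//.
have h1 := ler_wpM2l s0 (muP g Hg); have h2 := ler_wpM2l t0 (nuP g Hg).
have e1 : P = s * P + t * P by rewrite -mulrDl st1 mul1r.
have e2 : ln (lambda p g) = s * ln (lambda p g) + t * ln (lambda p g).
  by rewrite -mulrDl st1 mul1r.
lra.
Qed.

(** A limit of equilibrium states along an ultrafilter exists as a functional
    on [Cb]; uniform tightness makes it a countably additive measure. *)
Lemma equilibrium_compact : compact (equilibrium p alpha f).
Proof.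
rewrite compact_ultra => U UU Ueq.
have near_eq (Q : set (rba R X)) :
  (forall mu, equilibrium p alpha f mu -> Q mu) -> U Q.
  by move=> h; apply: filterS Ueq.
have st mu : equilibrium p alpha f mu -> state (pairing mu).
  by move=> /equilibriumP[mum _]; exact: Msigma_state.
pose L h := lim (pairing mu h @[mu --> U]).
have cvgL h : Cb h -> pairing mu h @[mu --> U] --> L h.
  move=> ch; have [M M0 hM] := Cb_bound ch.
  apply: (@ultra_bounded_cvg _ _ _ _ M) => //.
  by apply: near_eq => mu /st sm; exact: (state_norm sm ch hM).
have stL : state L.
  split.
  - move=> h k ch ck; apply: cvg_lim => //.
    rewrite (_ : (fun mu => _) = fun mu => pairing mu h + pairing mu k).
      by apply: cvgD; exact: cvgL.
    by apply/funext => mu; exact: pairingD.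
  - move=> k h ch; apply: cvg_lim => //.
    rewrite (_ : (fun mu => _) = fun mu => k * pairing mu h).
      by apply: cvgM; [exact: cvg_cst|exact: cvgL].
    by apply/funext => mu; exact: pairingZ.
  - move=> h ch h0; apply: (cvgr_to_ge (cvgL h ch)); apply: near_eq => mu /st sm.
    exact: (state_ge0 sm).
  - have c1 : Cb (fun _ : X => 1 : R) by exact: Cb_cst.
    apply/eqP; rewrite eq_le; apply/andP; split.
      apply: (cvgr_to_le (cvgL _ c1)); apply: near_eq => mu /st sm.
      by rewrite (state1 sm).
    apply: (cvgr_to_ge (cvgL _ c1)); apply: near_eq => mu /st sm.
    by rewrite (state1 sm).
have tL : tight L.
  move=> j eta delta eta0 delta0.
  have [F hF] := equilibrium_tight j eta0 delta0; exists F.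
  by apply: (cvgr_to_le (cvgL _ (Cb_bump_coord F j eta0))); exact: near_eq.
have [_ [mu muL]] := tight_representation stL tL.
exists mu; split; last first.
  by apply: rba_cvg => h ch; rewrite muL//; exact: cvgL.
apply/equilibriumP; split.
  split.
    split; first by rewrite muL ?(state1 stL)//; exact: Cb_cst.
    by move=> h ch h0; rewrite muL//; exact: (state_ge0 stL).
  move=> h ch; have cs := Cb_shift ch; rewrite !muL//.
  rewrite /L; congr (lim _); apply/seteqP.
  have near_inv A : U [set nu : rba R X | A (pairing nu (h \o @Defs.shift E))] <->
      U [set nu | A (pairing nu h)].
    by split; apply: filterS2 Ueq => nu /equilibriumP[[_ inv] _] /=; rewrite inv.
  by split => A; rewrite /fmap /=; apply near_inv.
move=> g Hg; have cg := proj1 Hg; rewrite !muL//.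
have cv : - pairing nu g + ln (lambda p g) + pairing nu f @[nu --> U] -->
    - L g + ln (lambda p g) + L f.
  apply: cvgD; last exact: cvgL.
  by apply: cvgD; [apply: cvgN; exact: cvgL|exact: cvg_cst].
apply: (cvgr_to_ge cv); apply: near_eq => nu /equilibriumP[_ nuP].
exact: nuP.
Qed.

End equilibrium.

Theorem proposition4p6 (R : realType) (E : completePMetricType R)
    (sepE : separable E) (p : probability (borel E) R)
    (alpha : R) (alpha0 : 0 < alpha) (alpha1 : alpha < 1)
    (f : seqspace E -> R) (fCb : Cb f) :
  [/\ equilibrium p alpha f `<=` Msigma,
      compact (equilibrium p alpha f) &
      convex_set (equilibrium p alpha f)].
Proof.
split; first by move=> mu [].
- exact: equilibrium_compact.
- exact: equilibrium_convex.
Qed.
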